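(* Let $\mathbb{K}$ be a field of characteristic zero, $R$ a polynomial ring over $\mathbb{K}$, and $A$ a $\mathbb{K}$-subalgebra that is a direct summand of $R$ (as an $A$-module), for which the inclusion $A\subseteq R$ is differentially extensible. Let $M$ be a $D_{A|\mathbb{K}}$-module that is a differentially extensible summand of a regular holonomic $D_{R|\mathbb{K}}$-module $N$ with quasi-unipotent monodromy. Suppose that $\underline f=f_1,\dots,f_\ell$ and $\underline g=g_1,\dots,g_m$ both generate an ideal $I\subseteq A$. Set $M'=H^\ell_{\langle\underline t-\underline f\rangle}(M[\underline t])$ and $M''=H^m_{\langle\underline u-\underline g\rangle}(M[\underline u])$, for sequences of indeterminates $\underline t=t_1,\dots,t_\ell$ and $\underline u=u_1,\dots,u_m$, and identify $M$ with both $0:_{M'}\langle\underline t-\underline f\rangle$ and $0:_{M''}\langle\underline u-\underline g\rangle$. Then for all $\alpha\in\mathbb{Q}$, $$V^\alpha_{\langle\underline t\rangle}M'\cap M=V^\alpha_{\langle\underline u\rangle}M''\cap M.$$ In particular, the $V$-filtration of $M$ along $\underline f$ depends only on the ideal $I$.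
   Context: For a commutative $\mathbb{K}$-algebra $B$, $D_{B|\mathbb{K}}$ is Grothendieck's ring of $\mathbb{K}$-linear differential operators; modules are left modules with action $\bullet$. $A\subseteq R$ is differentially extensible if every $\delta\in D_{A|\mathbb{K}}$ has an extension $\widetilde\delta\in D_{R|\mathbb{K}}$, i.e. $\widetilde\delta|_A=\delta$. With $\beta:R\to A$ an $A$-linear splitting, $M$ is a differentially extensible summand of $N$ if $M\subseteq N$, there is an $A$-linear splitting $\Theta:N\to M$ with $\Theta(\delta\bullet v)=(\beta\circ\delta|_A)\bullet v$ for all $\delta\in D_{R|\mathbb{K}}$, $v\in M$, and $\widetilde\delta\bullet m=\delta\bullet m$ for all $\delta\in D_{A|\mathbb{K}}$, all extensions $\widetilde\delta\in D_{R|\mathbb{K}}$ of $\delta$, and all $m\in M$. $\langle\underline t-\underline f\rangle=\langle t_1-f_1,\dots,t_\ell-f_\ell\rangle\subseteq A[\underline t]$, $M[\underline t]=M\otimes_{\mathbb K}\mathbb K[\underline t]$ and $M'$ is a $D_{A[\underline t]|\mathbb{K}}$-module; $m\in M$ is identified with the class of $m/\prod_i(t_i-f_i)$ in $M'$ (similarly for $\underline u,\underline g$). The $V$-filtration on $M$ along $\underline f$ is $V^\alpha M=V^\alpha_{\langle\underline t\rangle}M'\cap M$. For a Noetherian $\mathbb{K}$-algebra $B$, $V^i_{\langle\underline t\rangle}D_{B[\underline t]|\mathbb{K}}=\{\delta:\delta\bullet\langle\underline t\rangle^j\subseteq\langle\underline t\rangle^{j+i}\ \forall j\in\mathbb{Z}\}$,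 with $\langle\underline t\rangle^j=B[\underline t]$ for $j\le0$. A $V$-filtration along $\langle\underline t\rangle$ on a $D_{B[\underline t]|\mathbb{K}}$-module $P$ is a decreasing filtration $\{V_{\langle\underline t\rangle}^\alpha P\}_{\alpha\in\mathbb{Q}}$ such that: (1) each $V^\alpha P$ is a Noetherian $V^0_{\langle\underline t\rangle}D_{B[\underline t]|\mathbb{K}}$-submodule; (2) $\bigcup_\alpha V^\alpha P=P$; (3) $V^\alpha P=\bigcap_{\gamma<\alpha}V^\gamma P$, and the set of $\alpha$ with $V^\alpha P\ne\bigcup_{\gamma>\alpha}V^\gamma P$ is discrete; (4) $t_i\bullet V^\alpha P\subseteq V^{\alpha+1}P$, $\partial_{t_i}\bullet V^\alpha P\subseteq V^{\alpha-1}P$; (5) $\sum_it_i\bullet V^\alpha P=V^{\alpha+1}P$ for $\alpha\gg0$; (6) $\sum_i\partial_{t_i}t_i-\alpha$ acts nilpotently on $V^\alpha P/\bigcup_{\gamma>\alpha}V^\gamma P$. Under the hypotheses, $M'$ and $M''$ have $V$-filtrations along $\langle\underline t\rangle$ and $\langle\underline u\rangle$; these are the ones in the statement. Regular holonomic modules with quasi-unipotent monodromy are meant in the standard sense of Kashiwara and Malgrange (eigenvalues of local monodromies are roots of unity); over a general $\mathbb{K}$ this is understood via descent to a finitely generated subfield and extension of scalars along an embedding of it in $\mathbb{C}$.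
   Formalization: Condition (3) of a V-filtration is read as: finitely many jumps in each bounded interval, and V^α constant between jumps; without constancy, rationally indexed filtrations changing at an irrational place satisfy (1)–(6) and break the equality. *)

(* Defs.v *)
(* The notations of multinomials clash with those of MathComp-Analysis and are not
   imported: {mpoly R[n]} is written mpoly n R, 'X_[m] is mpolyX R m. *)
From HB Require Import structures.
From mathcomp Require Import all_boot all_order all_algebra.
From mathcomp Require Import -(notations) mpoly complex.
From mathcomp Require Import mathcomp_extra boolp classical_sets functions.
From mathcomp Require Import reals topology normedtype derive sequences exp trigo.

Set Implicit Arguments.
Unset Strict Implicit.
Unset Printing Implicit Defensive.

Import Order.TTheory GRing.Theory Num.Theory.
Import numFieldNormedType.Exports.

Local Open Scope classical_set_scope.
Local Open Scope ring_scope.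

Section DiffOp.
Variables (K : fieldType) (B : comAlgType K).

Fixpoint diff_order (k : nat) (d : B -> B) : Prop :=
  if k is k'.+1 then forall b, diff_order k' (fun x => d (b * x) - b * d x)
  else forall b x, d (b * x) = b * d x.

Definition is_diffop (d : B -> B) : Prop :=
  (forall (c : K) x y, d (c *: x + y) = c *: d x + d y) /\
  exists k, diff_order k d.

Record diffop := Diffop { diffop_fun :> B -> B; diffopP : is_diffop diffop_fun }.

Lemma diffop_ext (d e : diffop) : (forall x, d x = e x) -> d = e.
Proof.
case: d e => [d dP] [e eP] /= de.
have E : d = e by apply: funext.
by subst e; congr Diffop; exact: Prop_irrelevance.
Qed.

HB.instance Definition _ := gen_eqMixin diffop.
HB.instance Definition _ := gen_choiceMixin diffop.

Lemma diffopD (d : B -> B) : is_diffop d -> {morph d : x y / x + y}.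
Proof. by case=> dl _ x y; have := dl 1 x y; rewrite !scale1r. Qed.

Lemma diff_order_ext k (d e : B -> B) :
  (forall x, d x = e x) -> diff_order k d -> diff_order k e.
Proof. by move=> /funext ->. Qed.

Lemma diff_orderD k (d e : B -> B) : diff_order k d -> diff_order k e ->
  diff_order k (fun x => d x + e x).
Proof.
elim: k d e => [|k IH] d e /= hd he b; first by move=> x; rewrite hd he mulrDr.
apply: diff_order_ext (IH _ _ (hd b) (he b)) => x /=.
by rewrite mulrDr opprD addrACA.
Qed.

Lemma diff_orderN k (d : B -> B) : diff_order k d ->
  diff_order k (fun x => - d x).
Proof.
elim: k d => [|k IH] d /= hd b; first by move=> x; rewrite hd mulrN.
apply: diff_order_ext (IH _ (hd b)) => x /=.
by rewrite mulrN opprB opprK addrC.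
Qed.

Lemma diff_orderS k (d : B -> B) : diff_order k d -> diff_order k.+1 d.
Proof.
elim: k d => [|k IH] d hd b; last exact: IH (hd b).
by move=> c x /=; rewrite !hd !subrr mulr0.
Qed.

Lemma diff_order_leq k l (d : B -> B) : (k <= l)%N ->
  diff_order k d -> diff_order l d.
Proof.
move=> /subnK <-; elim: (l - k)%N => [//|m IH] hd.
by rewrite addSn; apply/diff_orderS/IH.
Qed.

Definition klin (d : B -> B) :=
  forall (c : K) x y, d (c *: x + y) = c *: d x + d y.

Lemma klin_comm d b : klin d -> klin (fun x => d (b * x) - b * d x).
Proof.
move=> dl c x y /=; rewrite mulrDr -scalerAr !dl mulrDr -scalerAr scalerBr.
by rewrite opprD addrACA.
Qed.

Lemma diff_order_comp k l (d e : B -> B) : klin d -> klin e ->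
  diff_order k d -> diff_order l e -> diff_order (k + l) (fun x => d (e x)).
Proof.
have [s ltks] := ubnP (k + l)%N; elim: s => // s IH in k l d e ltks *.
move=> dl el hd he.
have dB x y : d (x - y) = d x - d y.
  have /= D := dl (-1) y x; rewrite !scaleN1r in D.
  by rewrite addrC D addrC.
have S1 b : k != 0 ->
    diff_order (k.-1 + l) (fun x => d (b * e x) - b * d (e x)).
  case: k hd ltks => // k hd ltks _ /=; rewrite addSn in ltks.
  exact: (IH k l (fun x => d (b * x) - b * d x) e ltks
    (klin_comm b dl) el (hd b) he).
have S2 b : l != 0 ->
    diff_order (k + l.-1) (fun x => d (e (b * x) - b * e x)).
  case: l he ltks {S1} => // l he ltks _ /=; rewrite addnS in ltks.
  exact: (IH k l d (fun x => e (b * x) - b * e x) ltks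
    dl (klin_comm b el) hd (he b)).
have split b x : d (e (b * x)) - b * d (e x) =
    d (e (b * x) - b * e x) + (d (b * e x) - b * d (e x)).
  by rewrite dB addrA subrK.
case: (posnP k) => [k0|k_gt0].
- subst k; rewrite add0n.
  case: (posnP l) => [l0|l_gt0].
    by subst l => b x /=; rewrite he hd.
  move: l_gt0 he S2 {IH ltks S1}; case: l => // l _ he S2 b.
  apply: diff_order_ext (S2 b isT) => x /=.
  by rewrite split hd subrr addr0.
- case: (posnP l) => [l0|l_gt0].
    subst l; rewrite addn0.
    move: k_gt0 hd S1 {IH ltks S2}; case: k => // k _ hd S1 b.
    have := S1 b isT; rewrite addn0; apply: diff_order_ext => x /=.
    by rewrite split he subrr -[0](subrr (0 : B)) dB subrr add0r.
- move: k_gt0 hd S1 S2 {IH ltks}; case: k => // k _ hd S1 S2; rewrite addSn => b.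
  have S2b := S2 b (lt0n_neq0 l_gt0); rewrite addSn -addnS prednK // in S2b.
  by apply: diff_order_ext (diff_orderD S2b (S1 b isT)) => x; rewrite -split.
Qed.

Lemma is_diffop0 : is_diffop (fun=> 0).
Proof.
split=> [c x y|]; first by rewrite scaler0 addr0.
by exists 0%N => b x; rewrite mulr0.
Qed.

Lemma is_diffopD (d e : diffop) : is_diffop (fun x => d x + e x).
Proof.
case: d e => [d [dl [k dk]]] [e [el [l el']]] /=; split=> [c x y|].
  by rewrite dl el scalerDr addrACA.
exists (maxn k l); apply: diff_orderD.
- exact: diff_order_leq (leq_maxl _ _) dk.
- exact: diff_order_leq (leq_maxr _ _) el'.
Qed.

Lemma is_diffopN (d : diffop) : is_diffop (fun x => - d x).
Proof.
case: d => [d [dl [k dk]]] /=; split=> [c x y|].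
  by rewrite dl opprD scalerN.
by exists k; exact: diff_orderN.
Qed.

Lemma is_diffopM (d e : diffop) : is_diffop (fun x => d (e x)).
Proof.
case: d e => [d [dl [k dk]]] [e [el [l el']]] /=; split=> [c x y|].
  by rewrite el dl.
by exists (k + l)%N; exact: diff_order_comp.
Qed.

Lemma is_diffop_mul (b : B) : is_diffop (fun x => b * x).
Proof.
split=> [c x y|]; first by rewrite mulrDr scalerAr.
by exists 0%N => c x; rewrite mulrCA.
Qed.

Lemma is_diffop_derivation (d : B -> B) : klin d ->
  (forall x y, d (x * y) = d x * y + x * d y) -> is_diffop d.
Proof.
move=> dl dM; split=> //; exists 1%N => b c x.
by rewrite !dM addrK addrK mulrCA.
Qed.

Definition mulop (b : B) : diffop := Diffop (is_diffop_mul b).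

Let zero := Diffop is_diffop0.
Let opp d := Diffop (is_diffopN d).
Let add d e := Diffop (is_diffopD d e).
Let one := mulop 1.
Let mul d e := Diffop (is_diffopM d e).

Let addA : associative add.
Proof. by move=> d e h; apply: diffop_ext => x /=; rewrite addrA. Qed.
Let addC : commutative add.
Proof. by move=> d e; apply: diffop_ext => x /=; rewrite addrC. Qed.
Let add0 : left_id zero add.
Proof. by move=> d; apply: diffop_ext => x /=; rewrite add0r. Qed.
Let addN : left_inverse zero opp add.
Proof. by move=> d; apply: diffop_ext => x /=; rewrite addNr. Qed.

HB.instance Definition _ := GRing.isZmodule.Build diffop addA addC add0 addN.

Let mulA : associative mul.
Proof. by move=> d e h; apply: diffop_ext. Qed.
Let mul1 : left_id one mul.
Proof. by move=> d; apply: diffop_ext => x /=; rewrite mul1r. Qed.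
Let mulr1' : right_id one mul.
Proof. by move=> d; apply: diffop_ext => x /=; rewrite mul1r. Qed.
Let mulDl' : left_distributive mul add.
Proof. by move=> d e h; apply: diffop_ext. Qed.
Let mulDr' : right_distributive mul add.
Proof. by move=> d e h; apply: diffop_ext => x /=; rewrite (diffopD (diffopP d)). Qed.

HB.instance Definition _ :=
  GRing.Zmodule_isPzRing.Build diffop mulA mul1 mulr1' mulDl' mulDr'.

Definition dscale (M : lmodType diffop) (c : K) (v : M) : M :=
  mulop c%:A *: v.

End DiffOp.

Section Weyl.
Variables (K : fieldType) (n : nat).

Lemma mderiv_is_diffop (i : 'I_n) :
  is_diffop (fun p : mpoly n K => mderiv i p : mpoly n K).
Proof.
apply: is_diffop_derivation => [c x y|x y]; last exact: mderivM.
by rewrite linearP.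
Qed.

Definition dX (i : 'I_n) : diffop (mpoly n K) := Diffop (mderiv_is_diffop i).
Definition mX (i : 'I_n) : diffop (mpoly n K) := mulop (mpolyX K (mnm1 i)).

End Weyl.

(* A[t_1,...,t_l] with its structure of K-algebra (mpoly l A being an A-algebra) *)
Definition polyext (K : fieldType) (A : comAlgType K) (l : nat) : Type :=
  mpoly l A.

Section PolyExt.
Variables (K : fieldType) (A : comAlgType K) (l : nat).
Local Notation At := (polyext A l).

HB.instance Definition _ := GRing.ComNzRing.copy At (mpoly l A).

Let scale (c : K) (p : At) : At := (c%:A : A) *: (p : mpoly l A).

Let scaleA c d p : scale c (scale d p) = scale (c * d) p.
Proof. by rewrite /scale scalerA -scalerAl mul1r scalerA. Qed.
Let scale1 : left_id 1 scale.
Proof. by move=> p; rewrite /scale !scale1r. Qed.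
Let scaleDr : right_distributive scale +%R.
Proof. by move=> c p q; rewrite /scale scalerDr. Qed.
Let scaleDl p : {morph scale^~ p : c d / c + d}.
Proof. by move=> c d; rewrite /scale !scalerDl. Qed.

HB.instance Definition _ :=
  GRing.Zmodule_isLmodule.Build K At scaleA scale1 scaleDr scaleDl.

Let scaleAl (c : K) (p q : At) : c *: (p * q) = (c *: p) * q.
Proof. by rewrite /GRing.scale /= /scale -scalerAl. Qed.

HB.instance Definition _ := GRing.Lmodule_isLalgebra.Build K At scaleAl.
HB.instance Definition _ := GRing.Lalgebra_isComAlgebra.Build K At.

Definition tconst (a : A) : At := mpolyC l a.
Definition tmono (b : multinom l) : At := mpolyX A b.
Definition tvar (i : 'I_l) : At := tmono (mnm1 i).

Lemma tderiv_is_diffop (i : 'I_l) :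
  is_diffop (fun p : At => mderiv i p : At).
Proof.
apply: is_diffop_derivation => [c x y|x y]; last exact: mderivM.
exact: (linearP (mderiv i) (c%:A) (x : mpoly l A) y).
Qed.

Definition dT (i : 'I_l) : diffop At := Diffop (tderiv_is_diffop i).
Definition mT (i : 'I_l) : diffop At := mulop (tvar i).

End PolyExt.

Definition ideal_gen (B : comNzRingType) (l : nat) (h : 'I_l -> B) : set B :=
  [set b | exists c : 'I_l -> B, b = \sum_i c i * h i].

Section Summand.
Variables (K : fieldType) (A R : comAlgType K) (iota : {lrmorphism A -> R}).

Definition is_splitting (beta : R -> A) : Prop :=
  [/\ {morph beta : x y / x + y},
      forall a r, beta (iota a * r) = a * beta r
    & forall a, beta (iota a) = a].

Definition extends (d' : diffop R) (d : diffop A) : Prop :=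
  forall a, d' (iota a) = iota (d a).

Definition diff_extensible : Prop :=
  forall d : diffop A, exists d' : diffop R, extends d' d.

Variables (beta : R -> A) (betaP : is_splitting beta).

Lemma contract_subproof (d : diffop R) : is_diffop (fun a => beta (d (iota a))).
Proof.
have [bD bl _] := betaP.
have bB x y : beta (x - y) = beta x - beta y.
  apply/eqP; rewrite eq_sym subr_eq -bD subrK; exact/eqP.
have bZ (c : K) r : beta (c *: r) = c *: beta r.
  have -> : c *: r = iota (c%:A) * r.
    by rewrite linearZ /= rmorph1 -scalerAl mul1r.
  by rewrite bl -scalerAl mul1r.
case: d => [d [dl [k dk]]] /=; split=> [c x y|].
  by rewrite linearP dl bD bZ.
exists k; elim: k d dk {dl} => [|k IH] d dk a.
  by move=> x; rewrite rmorphM dk bl.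
apply: diff_order_ext (IH _ (dk (iota a))) => x /=.
by rewrite rmorphM bB bl.
Qed.

Definition contract (d : diffop R) : diffop A := Diffop (contract_subproof d).

Definition diff_ext_summand (M : lmodType (diffop A)) (N : lmodType (diffop R))
    (j : M -> N) : Prop :=
  [/\ injective j,
      {morph j : x y / x + y},
      forall a v, j (mulop a *: v) = mulop (iota a) *: j v,
      exists Theta : N -> M,
        [/\ {morph Theta : x y / x + y},
            forall a w, Theta (mulop (iota a) *: w) = mulop a *: Theta w,
            forall v, Theta (j v) = v
          & forall (d : diffop R) v, Theta (d *: j v) = contract d *: v]
    & forall (d : diffop A) (d' : diffop R), extends d' d ->
        forall v, d' *: j v = j (d *: v)].

End Summand.

(* Q is M[t] = M (x)_K K[t], with i v = v (x) 1: every element of Q is uniquely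
   a finite sum of t^b (v_b (x) 1).  The action of D_{A[t]} is the one of
   D_A (x)_K D_{K[t]}; it is determined by its values on the v (x) 1, where d
   acts through its restriction to A: if d a = sum_b t^b (e_b a) on A with e_b
   in D_A, then d (v (x) 1) = sum_b t^b (e_b v (x) 1). *)
Definition is_poly_module (K : fieldType) (A : comAlgType K) (l : nat)
    (M : lmodType (diffop A)) (Q : lmodType (diffop (polyext A l)))
    (i : {additive M -> Q}) : Prop :=
  [/\ forall q, exists (s : seq (multinom l)) (c : multinom l -> M),
        q = \sum_(b <- s) mulop (tmono A b) *: i (c b),
      forall (s : seq (multinom l)) (c : multinom l -> M), uniq s ->
        \sum_(b <- s) mulop (tmono A b) *: i (c b) = 0 ->
        forall b, b \in s -> c b = 0
    & forall (d : diffop (polyext A l)) (s : seq (multinom l))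
          (e : multinom l -> diffop A),
        (forall a, d (tconst l a) = \sum_(b <- s) tmono A b * tconst l (e b a)) ->
        forall v, d *: i v = \sum_(b <- s) mulop (tmono A b) *: i (e b *: v)].

Section LocalCohomology.
Variables (K : fieldType) (B : comAlgType K).
Implicit Types Q Qh H : lmodType (diffop B).

Definition is_localization (h : B) Q Qh (lambda : {linear Q -> Qh}) : Prop :=
  [/\ bijective (fun y : Qh => mulop h *: y),
      forall y, exists k q, mulop (h ^+ k) *: y = lambda q
    & forall q, lambda q = 0 -> exists k, mulop (h ^+ k) *: q = 0].

(* H = H^l_{(h_1,...,h_l)}(Q), as the cokernel of the last map of the Cech
   complex, (+)_i Q_{prod_(j != i) h_j} -> Q_{h_1 ... h_l}.  The image of the
   i-th summand consists of the z such that some power of prod_(j != i) h_j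
   maps z into the image of Q. *)
Definition is_top_local_cohomology (l : nat) (h : 'I_l -> B) Q Qh
    (lambda : {linear Q -> Qh}) H (pi : {linear Qh -> H}) : Prop :=
  [/\ is_localization (\prod_i h i) lambda,
      forall x, exists y, pi y = x
    & forall y, pi y = 0 <-> exists z : 'I_l -> Qh, y = \sum_i z i /\
        forall i, exists k q,
          mulop ((\prod_(j | j != i) h j) ^+ k) *: z i = lambda q].

End LocalCohomology.

Record graph_module (K : fieldType) (A : comAlgType K) (l : nat)
    (f : 'I_l -> A) (M : lmodType (diffop A)) := GraphModule {
  gm_poly : lmodType (diffop (polyext A l));
  gm_const : {additive M -> gm_poly};
  gm_polyP : is_poly_module gm_const;
  gm_loc : lmodType (diffop (polyext A l));
  gm_lambda : {linear gm_poly -> gm_loc};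
  gm_coh :> lmodType (diffop (polyext A l));
  gm_pi : {linear gm_loc -> gm_coh};
  gm_cohP : is_top_local_cohomology (fun i => tvar A i - tconst l (f i))
              gm_lambda gm_pi }.

(* The intersection of S with M, where v in M is identified with the class of
   v / prod_i (t_i - f_i) in M' = H^l_{<t - f>}(M[t]). *)
Definition meet_base (K : fieldType) (A : comAlgType K) (l : nat)
    (f : 'I_l -> A) (M : lmodType (diffop A)) (M' : graph_module f M)
    (S : set M') : set M :=
  [set v | exists y : gm_loc M',
     mulop (\prod_i (tvar A i - tconst l (f i))) *: y
       = gm_lambda M' (gm_const M' v) /\ S (gm_pi M' y)].

Definition ideal_power (B : comNzRingType) (l : nat) (h : 'I_l -> B) (j : int) :
    set B :=
  match j with
  | Posz k => [set b | exists c : {ffun 'I_k -> 'I_l} -> B,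
                b = \sum_s c s * \prod_(u < k) h (s u)]
  | Negz _ => setT
  end.

Section VFiltration.
Variables (K : fieldType) (A : comAlgType K) (l : nat).
Variable P : lmodType (diffop (polyext A l)).

Definition V_diffop (i : int) : set (diffop (polyext A l)) :=
  [set d | forall (j : int) b,
     ideal_power (@tvar K A l) j b -> ideal_power (@tvar K A l) (j + i) (d b)].

Definition is_V0_submodule (S : set P) : Prop :=
  [/\ S 0, forall x y, S x -> S y -> S (x + y)
    & forall d x, V_diffop 0 d -> S x -> S (d *: x)].

Definition is_noetherian_V0 (S : set P) : Prop :=
  is_V0_submodule S /\
  forall C : nat -> set P,
    (forall k, [/\ is_V0_submodule (C k), C k `<=` S & C k `<=` C k.+1]) ->
    exists k0, forall k, (k0 <= k)%N -> C k = C k0.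

Variable V : rat -> set P.

Definition V_gt (alpha : rat) : set P :=
  [set x | exists2 gamma, alpha < gamma & V gamma x].

Definition V_jump (alpha : rat) : Prop := V alpha <> V_gt alpha.

(* Discreteness of the set of jumps is read as finiteness in every bounded
   interval, together with constancy of V away from the jumps: as alpha only
   ranges over Q, the latter is what excludes changes of V at irrational
   places, which V_jump does not see. *)
Record is_V_filtration : Prop := IsVFiltration {
  Vf_decr : forall a b : rat, a <= b -> V b `<=` V a;
  Vf_noeth : forall a, is_noetherian_V0 (V a);
  Vf_exhaust : forall x, exists a, V a x;
  Vf_leftcont : forall a, V a = [set x | forall c, c < a -> V c x];
  Vf_discrete : forall a b : rat, exists s : seq rat,
    forall c, a <= c <= b -> V_jump c -> c \in s;
  Vf_constant : forall a b : rat, a <= b ->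
    (forall c, a <= c < b -> ~ V_jump c) -> V a = V b;
  Vf_mulT : forall i a x, V a x -> V (a + 1) (mT A i *: x);
  Vf_derT : forall i a x, V a x -> V (a - 1) (dT A i *: x);
  Vf_large : exists a0, forall a, a0 <= a ->
    V (a + 1) = [set x | exists z : 'I_l -> P,
                   (forall i, V a (z i)) /\ x = \sum_i mT A i *: z i];
  Vf_nilp : forall a, exists k, forall x, V a x ->
    V_gt a ((\sum_i dT A i * mT A i - mulop ((ratr a : K)%:A)) ^+ k *: x) }.

End VFiltration.

Section Holonomic.
Variables (K : fieldType) (n : nat).
Local Notation R := (mpoly n K).
Variable N : lmodType (diffop R).

Definition in_kspan (w : seq N) (y : N) : Prop :=
  exists c : 'I_(size w) -> K, y = \sum_i dscale (c i) w`_i.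

(* N is finitely generated and of Bernstein dimension at most n: with respect
   to the Bernstein filtration B_k = span {x^a d^b : |a| + |b| <= k} and a
   finite generating family s, dim_K B_k s = O(k^n).  By Bernstein's inequality
   the dimension is then n unless N = 0. *)
Definition holonomic : Prop :=
  exists s : seq N,
    (forall y : N, exists c : 'I_(size s) -> diffop R, y = \sum_i c i *: s`_i) /\
    exists e : nat, forall k : nat, exists w : seq N,
      (size w <= e * k.+1 ^ n)%N /\
      forall (a b : multinom n) z, (mdeg a + mdeg b <= k)%N -> z \in s ->
        in_kspan w ((mulop (mpolyX K a) * \prod_i dX K i ^+ b i) *: z).

Record good_filtration (F : int -> set N) : Prop := GoodFiltration {
  gf_zero : forall k, F k 0;
  gf_add : forall k x y, F k x -> F k y -> F k (x + y);
  gf_incr : forall k, F k `<=` F (k + 1);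
  gf_exhaust : forall x, exists k, F k x;
  gf_bounded : exists k, forall x, F k x -> x = 0;
  gf_fingen : forall k, exists s : seq N, (forall z, z \in s -> F k z) /\
    forall x, F k x -> exists c : 'I_(size s) -> R,
      x = \sum_i mulop (c i) *: s`_i;
  gf_act : forall (m : nat) (d : diffop R) k x, diff_order m d ->
    F k x -> F (k + m%:Z) (d *: x);
  gf_good : exists k0, forall k (m : nat) x, k0 <= k -> F (k + m%:Z) x ->
    exists r (d : 'I_r -> diffop R) (z : 'I_r -> N),
      (forall i, diff_order m (d i) /\ F k (z i)) /\ x = \sum_i d i *: z i }.

(* The principal symbol of order m of d vanishes on the characteristic variety
   of N, i.e. has a power that annihilates gr^F N. *)
Definition symbol_vanishes (F : int -> set N) (m : nat) (d : diffop R) : Prop :=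
  exists r : nat, (0 < r)%N /\
    forall k x, F k x -> F (k + (r * m)%N%:Z - 1) (d ^+ r *: x).

(* Kashiwara's definition: some good filtration F is such that the (radical)
   ideal of the characteristic variety annihilates gr^F N. *)
Definition regular_holonomic : Prop :=
  holonomic /\ exists F : int -> set N, good_filtration F /\
    forall (m : nat) (d : diffop R), diff_order m d -> symbol_vanishes F m d ->
      forall k x, F k x -> F (k + m%:Z - 1) (d *: x).

End Holonomic.

(* j : N -> P identifies P with L (x)_K N: it is semilinear, its image spans P,
   and it maps linearly independent families to linearly independent ones. *)
Definition is_scalar_extension (K L : fieldType) (sigma : K -> L)
    (N P : zmodType) (scN : K -> N -> N) (scP : L -> P -> P) (j : N -> P) :
    Prop :=
  [/\ {morph j : x y / x + y},
      forall c y, j (scN c y) = scP (sigma c) (j y),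
      forall p, exists r (c : 'I_r -> L) (y : 'I_r -> N),
        p = \sum_i scP (c i) (j (y i))
    & forall r (y : 'I_r -> N),
        (forall c, \sum_i scN (c i) (y i) = 0 -> forall i, c i = 0) ->
        forall c, \sum_i scP (c i) (j (y i)) = 0 -> forall i, c i = 0].

(* The same for modules over the Weyl algebras, which are generated by the
   scalars, the x_i and the d_i. *)
Definition is_dmod_extension (K L : fieldType) (sigma : K -> L) (n : nat)
    (N : lmodType (diffop (mpoly n K))) (P : lmodType (diffop (mpoly n L)))
    (j : N -> P) : Prop :=
  [/\ is_scalar_extension sigma (@dscale _ _ N) (@dscale _ _ P) j,
      forall i y, j (mX K i *: y) = mX L i *: j y
    & forall i y, j (dX K i *: y) = dX L i *: j y].

Definition fingen_field (K : fieldType) : Prop :=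
  exists s : seq K, forall S : set K,
    (forall x, x \in s -> S x) -> S 1 ->
    (forall x y, S x -> S y -> S (x - y)) ->
    (forall x y, S x -> S y -> S (x * y)) ->
    (forall x, S x -> S x^-1) ->
    forall x, S x.

Section Monodromy.
Variable RR : realType.
Local Notation C := (complex RR).

Local Notation "\near0 P" := (\forall s \near (0 : C^o)^', P s)
  (at level 10, P at level 9).

(* A differential field of germs at 0 of meromorphic functions of one complex
   variable, containing the constants; ger_fun x is a function defined near 0
   (and with arbitrary values elsewhere) that represents x. *)
Record germ_field := GermField {
  ger_sort :> fieldType;
  ger_const : {rmorphism C -> ger_sort};
  ger_der : ger_sort -> ger_sort;
  ger_fun : ger_sort -> C -> C;
  ger_constE : forall c, \near0 (fun s => ger_fun (ger_const c) s = c);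
  ger_addE : forall x y,
    \near0 (fun s => ger_fun (x + y) s = ger_fun x s + ger_fun y s);
  ger_mulE : forall x y,
    \near0 (fun s => ger_fun (x * y) s = ger_fun x s * ger_fun y s);
  ger_derE : forall x, \near0 (fun s =>
    is_derive (s : C^o) (1 : C^o) (ger_fun x : C^o -> C^o) (ger_fun (ger_der x) s));
  ger_mero : forall x, exists (k : nat) (b : C),
    \near0 (fun s => `|s ^+ k * ger_fun x s| <= b) }.

(* x is holomorphic at 0 (Riemann's removable singularity theorem) *)
Definition ger_holomorphic (L : germ_field) (x : L) : Prop :=
  exists b : C, \near0 (fun s => `|ger_fun x s| <= b).

(* Koszul complex of the operators theta_1, ..., theta_n; its chains, of all
   degrees at once, are the families indexed by the subsets of {1,...,n}. *)
Definition koszul_diff (L : fieldType) (P : lmodType L) (n : nat)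
    (theta : 'I_n -> P -> P) (w : {ffun {set 'I_n} -> P}) :
    {ffun {set 'I_n} -> P} :=
  [ffun S : {set 'I_n} => \sum_(i | i \notin S)
     (-1) ^+ #|[set u in S | (u < i)%N]| *: theta i (w (i |: S))].

(* The classes of the cycles e_1, ..., e_r form a basis of the homology, in
   which the matrix of the connection nabla is G. *)
Definition is_connection_matrix (L : fieldType) (P : lmodType L) (n : nat)
    (theta : 'I_n -> P -> P) (nabla : P -> P) (r : nat)
    (e : 'I_r -> {ffun {set 'I_n} -> P}) (G : 'M[L]_r) : Prop :=
  [/\ forall i, koszul_diff theta (e i) = 0,
      forall z, koszul_diff theta z = 0 -> exists (c : 'I_r -> L) w,
        z = \sum_i c i *: e i + koszul_diff theta w,
      forall (c : 'I_r -> L) w,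
        \sum_i c i *: e i = koszul_diff theta w -> forall i, c i = 0
    & forall k, exists w,
        [ffun S => nabla (e k S)] = \sum_i G i k *: e i + koszul_diff theta w].

Definition cexp (z : C) : C :=
  Complex (expR (complex.Re z) * cos (complex.Im z))
          (expR (complex.Re z) * sin (complex.Im z)).

Definition two_pi_i : C := Complex 0 (2 * pi).

(* T is the monodromy around 0 of the horizontal sections y of the connection
   d/ds + G, i.e. y' = - G y, in terms of a fundamental matrix Y of horizontal
   sections on the universal cover z |-> s = exp z of a punctured disc. *)
Definition is_monodromy (L : germ_field) (r : nat) (G : 'M[L]_r) (T : 'M[C]_r) :
    Prop :=
  exists (a : RR) (Y : C -> 'M[C]_r), forall z : C, complex.Re z < a ->
    [/\ Y z \in unitmx,
        forall i j, is_derive (z : C^o) (1 : C^o) (fun w : C^o => Y w i j : C^o)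
          (- (cexp z * \sum_k ger_fun (G i k) (cexp z) * Y z k j))
      & Y (z + two_pi_i) = Y z *m T].

(* For every holomorphic arc phi : (C, 0) -> C^n, the eigenvalues of the
   monodromy around 0 of all the L_k phi^* N = Tor_k^{C[x]}(N, L) are roots of
   unity.  Tor is computed by the Koszul complex of the x_i (x) 1 - 1 (x) phi_i
   on P = N (x)_C L; the connection is
   nabla (y (x) c) = y (x) c' + sum_i d_i y (x) phi_i' c.
   The horizontal sections are dual to the restrictions to the arc of the
   solution sheaves Ext^k_D(N, O), N being regular holonomic. *)
Definition quasi_unipotent_monodromy (n : nat)
    (N : lmodType (diffop (mpoly n C))) : Prop :=
  forall (L : germ_field) (phi : 'I_n -> L),
    (forall i, ger_holomorphic (phi i)) ->
  forall (P : lmodType L) (j : N -> P),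
    is_scalar_extension (ger_const L) (@dscale _ _ N) ( *:%R : L -> P -> P) j ->
  forall (X : 'I_n -> {linear P -> P}) (nabla : {additive P -> P}),
    (forall i y, X i (j y) = j (mX C i *: y)) ->
    (forall c y, nabla (c *: j y) = ger_der c *: j y +
       c *: \sum_i ger_der (phi i) *: j (dX C i *: y)) ->
  forall (r : nat) (e : 'I_r -> {ffun {set 'I_n} -> P}) (G : 'M[L]_r),
    is_connection_matrix (fun i p => X i p - phi i *: p) nabla e G ->
  forall T : 'M[C]_r, is_monodromy G T ->
  forall a : C, eigenvalue T a -> exists k : nat, (0 < k)%N /\ a ^+ k = 1.

(* Over a general field: N comes from a module N0 over a finitely generated
   subfield K0 that becomes regular holonomic with quasi-unipotent monodromy
   after extension of scalars along an embedding of K0 in C. *)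
Definition qu_regular_holonomic (K : fieldType) (n : nat)
    (N : lmodType (diffop (mpoly n K))) : Prop :=
  exists (K0 : fieldType) (inc : {rmorphism K0 -> K}) (emb : {rmorphism K0 -> C})
      (N0 : lmodType (diffop (mpoly n K0))) (j : N0 -> N)
      (NC : lmodType (diffop (mpoly n C))) (jC : N0 -> NC),
    [/\ fingen_field K0, is_dmod_extension inc j, is_dmod_extension emb jC,
        regular_holonomic NC & quasi_unipotent_monodromy NC].

End Monodromy.

(* Main.v *)
(* For g = c f and f = d g, let Psi : M' -> M'' be the push-forward along the
   A-linear map u = c t: it sends the class delta(v) of v in M' to the one in
   M'', and intertwines the action of sum_i c_ji t_i with that of u_j and
   dT_i with sum_j c_ji dU_j.  It is obtained from the moments: an element x of
   M' is determined by the rho(t^w x), where rho is the projection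
   M' -> M'/sum_i dT_i M' = M, and Psi x is the element whose moments are
   the rho((c t)^w x).  It suffices to show that Psi (V^a M') is contained in
   W^a M'', the rest being symmetry.

   Psi intertwines the Euler operators sum_i dT_i t_i and sum_j dU_j u_j.
   As Euler - a is nilpotent on V^a/V^{>a} and Euler - b on W^b/W^{>b}, an x
   in V^a with Psi x in W^b, b < a, is the sum of an element of V^{>a} and
   of an element that Psi maps to W^{>b}; climbing up the finitely many jumps,
   it is enough to find, for each a, some g with Psi (V^g) contained in W^a.
   For this, Vgraph b = {x | Psi (t^w x) in W^(b + |w|) for all w} is an exhaustive
   filtration of M' by V^0 D_{A[t]}-submodules (this uses f = d g), so that
   V^g is contained in some Vgraph b by the Noetherian property, whence
   V^(g + k) = (t)^k V^g is contained in Vgraph (b + k) if g is large.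

   The stability of Vgraph b under V^0 D_{A[t]} uses that D_{A[t]} is
   generated by D_A, t and dT, that is, that the expansion of an operator
   A -> A[t] in powers of t is finite.  Since A embeds in a polynomial ring, it
   has a finite transcendence basis, and an operator of order <= k that kills a
   suitable finite set of elements of A is zero. *)
Require Import Defs.
From mathcomp Require Import all_boot all_order all_algebra.
From mathcomp Require Import -(notations) mpoly complex.
From mathcomp Require Import ring.
From mathcomp Require Import boolp classical_sets functions reals.

Set Implicit Arguments.
Unset Strict Implicit.
Unset Printing Implicit Defensive.

Import Order.TTheory GRing.Theory Num.Theory.
Local Open Scope classical_set_scope.
Local Open Scope ring_scope.

(* mpoly exports a [tmono] too. *)
Local Notation tmono := Defs.tmono.

(** * Differential operators on A and A[t] *)

Lemma sum_delta (R : pzRingType) (I : eqType) (s : seq I) (F : I -> R) b :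
  uniq s -> \sum_(c <- s) F c * (c == b)%:R = if b \in s then F b else 0.
Proof.
move=> us; case: ifPn => bs.
  rewrite (bigD1_seq b) //= eqxx mulr1 big1 ?addr0 // => c /negbTE ->.
  exact: mulr0.
rewrite big_seq big1 // => c cs; case: eqP => [cb|_]; last by rewrite mulr0.
by rewrite -cb cs in bs.
Qed.

Section DiffopTheory.
Variables (K : fieldType) (B : comAlgType K).
Implicit Types (d e : diffop B) (b : B).

Lemma diffopEadd d e x : (d + e) x = d x + e x. Proof. by []. Qed.
Lemma diffopEopp d x : (- d) x = - d x. Proof. by []. Qed.
Lemma diffopEmul d e x : (d * e) x = d (e x). Proof. by []. Qed.
Lemma diffopE0 x : (0 : diffop B) x = 0. Proof. by []. Qed.
Lemma mulopE b x : mulop b x = b * x. Proof. by []. Qed.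

Lemma diffop_sumE (I : Type) (r : seq I) (P : pred I) (F : I -> diffop B) x :
  (\sum_(i <- r | P i) F i) x = \sum_(i <- r | P i) F i x.
Proof. by elim/big_rec2: _ => // i y z _ <-. Qed.

Lemma diffop_linear d (c : K) x y : d (c *: x + y) = c *: d x + d y.
Proof. by case: (diffopP d). Qed.
Lemma diffop_add d x y : d (x + y) = d x + d y.
Proof. exact: (diffopD (diffopP d)). Qed.
Lemma diffop0 d : d 0 = 0.
Proof. by apply: (addIr (d 0)); rewrite -diffop_add !add0r. Qed.
Lemma diffop_scale d (c : K) x : d (c *: x) = c *: d x.
Proof. by have := diffop_linear d c x 0; rewrite diffop0 !addr0. Qed.

Lemma mulopD b c : mulop (b + c) = mulop b + mulop c.
Proof. by apply: diffop_ext => x; rewrite /= mulrDl. Qed.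
Lemma mulopN b : mulop (- b) = - mulop b.
Proof. by apply: diffop_ext => x; rewrite /= mulNr. Qed.
Lemma mulopB b c : mulop (b - c) = mulop b - mulop c.
Proof. by rewrite mulopD mulopN. Qed.
Lemma mulopM b c : mulop (b * c) = mulop b * mulop c.
Proof. by apply: diffop_ext => x; rewrite /= mulrA. Qed.
Lemma mulop1 : mulop (1 : B) = 1. Proof. by []. Qed.
Lemma mulop0 : mulop (0 : B) = 0.
Proof. by apply: diffop_ext => x; rewrite /= mul0r. Qed.
Lemma mulop_sum (I : Type) (r : seq I) (P : pred I) (F : I -> B) :
  mulop (\sum_(i <- r | P i) F i) = \sum_(i <- r | P i) mulop (F i).
Proof. by elim/big_rec2: _ => [|i y z _ <-]; rewrite ?mulop0 ?mulopD. Qed.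
Lemma mulop_comm b c : mulop b * mulop c = mulop c * mulop b.
Proof. by rewrite -!mulopM mulrC. Qed.

Lemma mulop_scalar_comm (c : K) d : mulop (c%:A) * d = d * mulop (c%:A).
Proof.
by apply: diffop_ext => x; rewrite /= !mulr_algl diffop_scale.
Qed.

Lemma klin_mul b : klin (fun x => b * x).
Proof. by case: (is_diffop_mul b). Qed.

Lemma mulop_nat k : mulop (k%:R : B) = k%:R.
Proof. by elim: k => [|k IH]; rewrite ?mulop0 // !mulrS mulopD IH. Qed.

Definition order_le k d := diff_order k d.
(** Strict bound on the order, with order below 0 read as being zero. [bracket] then lowers the
    bound by exactly one, down to the zero operator, which is what ends the inductions on the
    order. *)
Definition order_lt k d := if k is k'.+1 then order_le k' d else d = 0.
Definition bracket d b := d * mulop b - mulop b * d.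

Lemma order_comm k d b : order_le k.+1 d -> order_le k (bracket d b).
Proof. exact. Qed.

Lemma order0_comm d b : order_le 0 d -> d * mulop b = mulop b * d.
Proof. by move=> H; apply: diffop_ext => x; rewrite /= H. Qed.

Lemma order_comm_pred k d b : order_le k d ->
  order_le k.-1 (bracket d b).
Proof.
case: k => [/order0_comm H|k]; last exact.
by rewrite /bracket H subrr => a x /=; rewrite mulr0.
Qed.

Lemma order_lt_bracket k d b : order_lt k.+1 d -> order_lt k (bracket d b).
Proof.
case: k => [/order0_comm E|k E]; last exact: E.
by rewrite /= /bracket E subrr.
Qed.

(** Jacobi identity, the multiplications by [b] and [b'] commuting. *)
Lemma bracketC d b b' : bracket (bracket d b) b' = bracket (bracket d b') b.
Proof.
rewrite /bracket; have := mulop_comm b b'.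
move: (mulop b) (mulop b') => x y C.
rewrite !mulrBl !mulrBr -!mulrA C [y * (x * d)]mulrA -C -[x * y * d]mulrA !opprB.
by rewrite addrACA [RHS]addrACA [- (x * _) - _]addrC.
Qed.

Lemma orderP d : exists k, order_le k d.
Proof. by case: (diffopP d). Qed.

Lemma order_mulop b : order_le 0 (mulop b).
Proof. by move=> c x /=; rewrite mulrCA. Qed.

Lemma order_zero k : order_le k (0 : diffop B).
Proof. by apply: (@diff_order_leq _ _ 0) => // b x /=; rewrite mulr0. Qed.

Lemma order_leq k k' d : (k <= k')%N -> order_le k d -> order_le k' d.
Proof. exact: diff_order_leq. Qed.

Lemma order_add k d e : order_le k d -> order_le k e -> order_le k (d + e).
Proof. exact: diff_orderD. Qed.


Lemma order_mul k k' d e : order_le k d -> order_le k' e ->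
  order_le (k + k') (d * e).
Proof. by move=> ? ?; apply: diff_order_comp => //; [case: (diffopP d)|case: (diffopP e)]. Qed.

Lemma order_sum k (I : Type) (r : seq I) (P : pred I) (F : I -> diffop B) :
  (forall i, P i -> order_le k (F i)) -> order_le k (\sum_(i <- r | P i) F i).
Proof.
by move=> H; apply: (big_ind (order_le k)) => //;
  [exact: order_zero | move=> *; exact: order_add].
Qed.

End DiffopTheory.

(** * Coefficientwise action of D_A on A[t] *)

Section Lift.
Variables (K : fieldType) (A : comAlgType K) (l : nat).
Local Notation At := (polyext A l).
Implicit Types (e : diffop A) (p : At).

(** For e in D_A this is the operator e (x) 1 of D_A (x) D_K[t]. *)
Definition lift_fun (e : A -> A) (p : At) : At :=
  \sum_(b <- msupp p) tmono A b * tconst l (e (mcoeff b p)).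


Lemma scaleE (c : K) p b : mcoeff b (c *: p : At) = c *: mcoeff b p.
Proof. by rewrite (@mcoeffZ l A) -scalerAl mul1r. Qed.

Lemma lift_funE e p b : mcoeff b (lift_fun e p) = e (mcoeff b p).
Proof.
rewrite /lift_fun raddf_sum /=.
under eq_bigr do rewrite mulrC mcoeffCM mcoeffX.
rewrite sum_delta ?msupp_uniq //; case: ifPn => // bp.
by rewrite (memN_msupp_eq0 bp) diffop0.
Qed.

Lemma polyext_ext p q : (forall b, mcoeff b p = mcoeff b q) -> p = q.
Proof. by move/mpolyP. Qed.

Lemma lift_klin e : klin (lift_fun e).
Proof.
move=> c x y; apply: polyext_ext => b.
by rewrite mcoeffD scaleE !lift_funE mcoeffD scaleE diffop_linear.
Qed.

Lemma polyext_expand p : p = \sum_(b <- msupp p) tmono A b * tconst l (mcoeff b p).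
Proof.
by rewrite [LHS](@mpolyE l A); apply: eq_bigr => b _; rewrite mulrC -mul_mpolyC.
Qed.

Lemma lift_fun_mono e b a :
  lift_fun e (tmono A b * tconst l a) = tmono A b * tconst l (e a).
Proof.
apply: polyext_ext => c; rewrite lift_funE.
rewrite ![tmono A b * _]mulrC !mcoeffCM !mcoeffX.
by case: eqP => _; rewrite ?mulr1 // !mulr0 diffop0.
Qed.

Lemma lift_fun_add e p q : lift_fun e (p + q) = lift_fun e p + lift_fun e q.
Proof. by have := lift_klin e 1 p q; rewrite !scale1r. Qed.

Lemma polyext_ind (P : At -> Prop) : P 0 -> (forall p q, P p -> P q -> P (p + q)) ->
  (forall b a, P (tmono A b * tconst l a)) -> forall p, P p.
Proof.
move=> P0 PD PM p; rewrite (polyext_expand p).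
by apply: (big_ind P) => // b _; apply: PM.
Qed.

Lemma lift_fun0 e : lift_fun e 0 = 0.
Proof. by rewrite /lift_fun msupp0 big_nil. Qed.

Lemma lift_fun_tmono e b p : lift_fun e (tmono A b * p) = tmono A b * lift_fun e p.
Proof.
elim/polyext_ind: p => [|p q IHp IHq|c a].
- by rewrite !(mulr0, lift_fun0).
- by rewrite mulrDr !lift_fun_add IHp IHq mulrDr.
- by rewrite lift_fun_mono !mulrA -[tmono A b * tmono A c](mpolyXD A) -lift_fun_mono.
Qed.

End Lift.

Section LiftOp.
Variables (K : fieldType) (A : comAlgType K) (l : nat).
Local Notation At := (polyext A l).
Implicit Types (e : diffop A) (p : At).

(** The commutator with t^b a is t^b times the lift of [e, a]. Commutators are additive in the
    multiplier, so monomials suffice in the induction on the order. *)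
Lemma lift_fun_order k e : order_le k e -> diff_order k (lift_fun e : At -> At).
Proof.
have lf0 (x : At) : lift_fun (0 : diffop A) x = 0 :> At.
  by apply: polyext_ext => b; rewrite lift_funE mcoeff0.
have key (e' : diffop A) b a (x : At) :
    lift_fun e' (tmono A b * tconst l a * x) - tmono A b * tconst l a * lift_fun e' x
    = tmono A b * lift_fun (bracket e' a) x :> At.
  rewrite -!mulrA lift_fun_tmono -mulrBr; congr (_ * _); apply: polyext_ext => c.
  by rewrite mcoeffB mcoeffCM !lift_funE mcoeffCM.
elim: k e => [|k IH] e ek.
  move=> b x; apply/eqP; rewrite -subr_eq0; apply/eqP.
  elim/polyext_ind: b => [|p q IHp IHq|b a]; first by rewrite !mul0r subr0 lift_fun0.
    by rewrite !mulrDl lift_fun_add opprD addrACA IHp IHq addr0.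
  by rewrite key /bracket (order0_comm _ ek) subrr lf0 mulr0.
move=> b; elim/polyext_ind: b => [|p q IHp IHq|b a].
- apply: diff_order_ext (order_zero At k) => x.
  by rewrite !mul0r subr0 lift_fun0.
- apply: diff_order_ext (diff_orderD IHp IHq) => x /=.
  by rewrite !mulrDl lift_fun_add opprD addrACA.
- pose e' := bracket e a.
  have := diff_order_comp (klin_mul (tmono A b)) (lift_klin (l := l) e')
     (order_mulop (tmono A b)) (IH e' (order_comm a ek)).
  by apply: diff_order_ext => x; rewrite key.
Qed.

Lemma is_diffop_lift e : is_diffop (lift_fun e : At -> At).
Proof.
split; first exact: lift_klin.
by have [k ek] := orderP e; exists k; apply: lift_fun_order.
Qed.

Definition liftop e : diffop At := Diffop (is_diffop_lift e).

Lemma coef_lift e p b : mcoeff b (liftop e p) = e (mcoeff b p).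
Proof. exact: lift_funE. Qed.


Lemma liftopD e e' : liftop (e + e') = liftop e + liftop e'.
Proof.
by apply: diffop_ext => x; apply: polyext_ext => b; rewrite mcoeffD !coef_lift.
Qed.
Lemma liftopN e : liftop (- e) = - liftop e.
Proof.
by apply: diffop_ext => x; apply: polyext_ext => b; rewrite mcoeffN !coef_lift.
Qed.
Lemma liftopB e e' : liftop (e - e') = liftop e - liftop e'.
Proof. by rewrite liftopD liftopN. Qed.
Lemma liftopM e e' : liftop (e * e') = liftop e * liftop e'.
Proof. by apply: diffop_ext => x; apply: polyext_ext => b; rewrite !coef_lift. Qed.
Lemma liftop_mulop a : liftop (mulop a) = mulop (tconst l a).
Proof.
by apply: diffop_ext => x; apply: polyext_ext => b; rewrite coef_lift mcoeffCM.
Qed.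
Lemma liftop0 : liftop 0 = 0.
Proof. by apply: (addIr (liftop 0)); rewrite -liftopD !add0r. Qed.

Lemma liftop_tconst e a : liftop e (tconst l a) = tconst l (e a).
Proof.
apply: polyext_ext => b; rewrite coef_lift !mcoeffC.
by case: eqP => _; rewrite ?mulr1 // !mulr0 diffop0.
Qed.

Lemma liftop_tmono e b : liftop e * mulop (tmono A b) = mulop (tmono A b) * liftop e.
Proof. by apply: diffop_ext => x; exact: lift_fun_tmono. Qed.

Lemma liftop_mT e (i : 'I_l) : liftop e * mT A i = mT A i * liftop e.
Proof. exact: liftop_tmono. Qed.

Lemma liftop_dT e (i : 'I_l) : liftop e * dT A i = dT A i * liftop e.
Proof.
apply: diffop_ext => x; apply: polyext_ext => b.
rewrite coef_lift !mcoeff_mderiv coef_lift.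
by elim: (b i).+1 => [|k IH]; rewrite ?mulr0n ?diffop0 // !mulrS diffop_add IH.
Qed.

Lemma mT_comm (i j : 'I_l) : mT A i * mT A j = mT A j * mT A i.
Proof. exact: mulop_comm. Qed.

Lemma dT_comm (i j : 'I_l) : dT A i * dT A j = dT A j * dT A i.
Proof. by apply: diffop_ext => x; apply: mderiv_comm. Qed.

Lemma dT_mT (i j : 'I_l) : dT A i * mT A j = mT A j * dT A i + (i == j)%:R.
Proof.
rewrite -mulop_nat; apply: diffop_ext => x.
rewrite !(diffopEadd, diffopEmul, mulopE) /=.
rewrite [mderiv i _](mderivM i (tvar A j : mpoly l A) x) addrC; congr (_ + _).
rewrite [mderiv i _](mderivX A i (mnm1 j)) mnm1E eq_sym.
case: eqP => [->|_]; last by rewrite scale0r.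
rewrite scale1r [mnm_sub _ _](_ : _ = mnm0) ?mpolyX0 //.
by apply/mnmP=> k; rewrite mnmBE subnn mnm0E.
Qed.

End LiftOp.

Arguments liftop {K A} l e.

(** * The graph module *)

Section Aux.

Definition addspan (T : nmodType) (X : set T) : set T :=
  [set x | forall Y : set T, Y 0 -> (forall a b, Y a -> Y b -> Y (a + b)) ->
     X `<=` Y -> Y x].

Lemma mnm_ind l (P : multinom l -> Prop) : P (mnm0 : multinom l) ->
  (forall i b, P b -> P (mnm_add (mnm1 i) b)) -> forall b, P b.
Proof.
move=> P0 PS b; have [d] := ubnP (mdeg b); elim: d b => // d IH b.
case: (eqVneq (mdeg b) 0%N) => [/eqP|b0].
  by rewrite mdeg_eq0 => /eqP -> _.
have [i bi] : exists i, (0 < b i)%N.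
  apply: contrapT => H; move: b0; rewrite mdegE big1 // => i _.
  by apply/eqP; rewrite -leqn0 leqNgt; apply/negP => bi; apply: H; exists i.
have bE : b = mnm_add (mnm1 i) (mnm_sub b (mnm1 i)).
  apply/mnmP => k; rewrite mnmDE mnmBE mnm1E subnKC //.
  by case: eqP => [<-|].
rewrite bE mdegD mdeg1 add1n ltnS => bd; exact: PS (IH _ bd).
Qed.

Lemma tmonoS (K : fieldType) (A : comAlgType K) l (i : 'I_l) b :
  tmono A (mnm_add (mnm1 i) b) = tvar A i * tmono A b.
Proof. exact: (mpolyXD A). Qed.

Lemma tmono0 (K : fieldType) (A : comAlgType K) l :
  tmono A (mnm0 : multinom l) = 1.
Proof. exact: mpolyX0. Qed.

Lemma nat_neq0 (K : fieldType) (charK : [pchar K] =i pred0) k : k.+1%:R != 0 :> K.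
Proof. by rewrite ((pcharf0P K).1 charK k.+1). Qed.

Lemma natr_comm (R : pzRingType) (x : R) k : x * k%:R = k%:R * x.
Proof. by rewrite mulr_natl mulr_natr. Qed.

Lemma natinv_mul (K : fieldType) (charK : [pchar K] =i pred0) (B : comAlgType K) k :
  (k.+1%:R^-1 : K)%:A * k.+1%:R = 1 :> B.
Proof.
by rewrite -(scaler_nat k.+1 1) -scalerAr mulr1 scalerA mulfV ?scale1r ?nat_neq0.
Qed.

End Aux.

(** * Fractions with poles along the graph *)

Section GraphModule.
Variables (K : fieldType) (charK : [pchar K] =i pred0) (A : comAlgType K).
Variables (l : nat) (f : 'I_l -> A) (M : lmodType (diffop A)).
Variable (G : graph_module f M).
Local Notation At := (polyext A l).
Local Notation Q := (gm_poly G).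
Local Notation Qh := (gm_loc G).
Local Notation i0 := (gm_const G).
Local Notation lam := (gm_lambda G).
Local Notation pi := (gm_pi G).

Definition graph_eq (i : 'I_l) : At := tvar A i - tconst l (f i).
Local Notation P i := (mulop (graph_eq i)).
Local Notation h := (\prod_i graph_eq i).

Lemma graph_eqE i : P i = mT A i - liftop l (mulop (f i)).
Proof. by rewrite /graph_eq mulopB liftop_mulop. Qed.

Lemma graph_eq_comm i j : P i * P j = P j * P i.
Proof. exact: mulop_comm. Qed.

Lemma dT_P i j : dT A j * P i = P i * dT A j + (j == i)%:R.
Proof. by rewrite graph_eqE mulrBr mulrBl dT_mT -liftop_dT addrAC. Qed.

Lemma liftop_P e i : liftop l e * P i = P i * liftop l e - liftop l (bracket e (f i)).
Proof.
rewrite graph_eqE mulrBr mulrBl liftop_mT -!liftopM /bracket liftopB opprB.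
by rewrite addrA subrK.
Qed.


Lemma const_lift e v : liftop l e *: i0 v = i0 (e *: v).
Proof.
have [_ _ H] := gm_polyP G.
rewrite (H (liftop l e) [:: mnm0] (fun=> e)); last first.
  by move=> a; rewrite big_seq1 liftop_tconst tmono0 mul1r.
by rewrite big_seq1 tmono0 mulop1 scale1r.
Qed.

Lemma const_dT i v : dT A i *: i0 v = 0.
Proof.
have [_ _ H] := gm_polyP G.
rewrite (H (dT A i) [::] (fun=> 0)) ?big_nil // => a.
by rewrite big_nil; apply: (@mderivC l A).
Qed.

Lemma prod_graph_eqE i : h = graph_eq i * \prod_(j | j != i) graph_eq j.
Proof. exact: bigD1. Qed.

Lemma h_bij : bijective (fun y : Qh => mulop h *: y).
Proof. by have [[]] := gm_cohP G. Qed.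

Lemma hinv_ex (y : Qh) : exists x, mulop h *: x = y.
Proof. by have [g _ gK] := h_bij; exists (g y). Qed.

Definition hinv y := sval (cid (hinv_ex y)).

Lemma hinvK y : mulop h *: hinv y = y.
Proof. by rewrite /hinv; case: cid. Qed.

Lemma h_inj (x y : Qh) : mulop h *: x = mulop h *: y -> x = y.
Proof. exact: (bij_inj h_bij). Qed.

(** Division by t_i - f_i. The localization inverts the product of all graph equations, so the other
    factors are multiplied back. *)
Definition pole i y : Qh := mulop (\prod_(j | j != i) graph_eq j) *: hinv y.

Lemma poleK i y : P i *: pole i y = y.
Proof. by rewrite scalerA -mulopM -prod_graph_eqE hinvK. Qed.

Lemma P_inj i (x y : Qh) : P i *: x = P i *: y -> x = y.
Proof.
move=> /(congr1 (fun z => mulop (\prod_(j | j != i) graph_eq j) *: z)).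
by rewrite !scalerA -!mulopM [_ * graph_eq i]mulrC -!prod_graph_eqE => /h_inj.
Qed.

Lemma poleD i x y : pole i (x + y) = pole i x + pole i y.
Proof. by apply: (@P_inj i); rewrite scalerDr !poleK. Qed.

Lemma pole0 i : pole i 0 = 0.
Proof. by apply: (@P_inj i); rewrite scaler0 poleK. Qed.

Lemma poleN i x : pole i (- x) = - pole i x.
Proof. by apply: (@P_inj i); rewrite scalerN !poleK. Qed.

(** The rule d P^-1 = P^-1 d + P^-1 [P, d] P^-1 for P = t_i - f_i. *)
Lemma op_pole d i y :
  d *: pole i y = pole i (d *: y) + pole i ((P i * d - d * P i) *: pole i y).
Proof.
apply: (@P_inj i); rewrite scalerDr !poleK scalerBl -![(_ * _) *: _]scalerA poleK.
by rewrite addrC subrK.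
Qed.

Lemma op_pole_comm d i y : P i * d = d * P i -> d *: pole i y = pole i (d *: y).
Proof. by move=> E; rewrite op_pole E subrr scale0r pole0 addr0. Qed.

Lemma pole_comm i j y : pole i (pole j y) = pole j (pole i y).
Proof.
apply: (@P_inj j); rewrite poleK op_pole_comm; last exact: graph_eq_comm.
by rewrite poleK.
Qed.

Definition polew w y := foldr pole y w.

Lemma polew_comm i w y : pole i (polew w y) = polew w (pole i y).
Proof. by elim: w => //= j w IH; rewrite pole_comm IH. Qed.

Lemma polewD w x y : polew w (x + y) = polew w x + polew w y.
Proof. by elim: w => //= j w ->; rewrite poleD. Qed.
Lemma polew0 w : polew w 0 = 0.
Proof. by elim: w => //= j w ->; rewrite pole0. Qed.

Lemma polewK w y : mulop (\prod_(i <- w) graph_eq i) *: polew w y = y.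
Proof.
elim: w => [|i w IH] /=; first by rewrite big_nil mulop1 scale1r.
by rewrite big_cons mulrC mulopM -scalerA poleK IH.
Qed.

Lemma polew_enum y : polew (index_enum 'I_l) y = hinv y.
Proof. by apply: h_inj; rewrite hinvK polewK. Qed.

(** The fraction v / prod_i (t_i - f_i), which represents the copy of v in M'. *)
Definition delta0 v : Qh := hinv (lam (i0 v)).
Definition delta v : G := pi (delta0 v).

Lemma delta0E v : delta0 v = polew (index_enum 'I_l) (lam (i0 v)).
Proof. by rewrite polew_enum. Qed.

Lemma deltaD v w : delta (v + w) = delta v + delta w.
Proof. by rewrite /delta !delta0E !raddfD /= polewD raddfD. Qed.

Lemma delta_0 : delta 0 = 0.
Proof. by apply: (addIr (delta 0)); rewrite -deltaD !add0r. Qed.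

Lemma deltaN v : delta (- v) = - delta v.
Proof. by apply/eqP; rewrite -addr_eq0 -deltaD addNr delta_0. Qed.

Lemma dT_pole (i j : 'I_l) y :
  dT A i *: pole j y = pole j (dT A i *: y) - (i == j)%:R *: pole j (pole j y).
Proof.
rewrite [LHS]op_pole dT_P opprD addNKr; case: eqP => _.
  by rewrite scaleN1r scale1r poleN.
by rewrite oppr0 !scale0r pole0 oppr0.
Qed.

Lemma dT_polew (i : 'I_l) w y :
  dT A i *: polew w y = polew w (dT A i *: y) - (count_mem i w)%:R *: pole i (polew w y).
Proof.
elim: w => [|j w IH] /=; first by rewrite scale0r subr0.
rewrite dT_pole IH natrD scalerDl opprD.
have -> : pole j (polew w (dT A i *: y) - (count_mem i w)%:R *: pole i (polew w y))
  = pole j (polew w (dT A i *: y)) - (count_mem i w)%:R *: pole i (pole j (polew w y)).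
  rewrite poleD -scaleNr -op_pole_comm; last first.
    by rewrite mulrN mulNr -mulop_nat mulop_comm.
  by rewrite pole_comm scaleNr.
rewrite addrAC -addrA [i == j]eq_sym; congr (_ + _).
by case: eqP => [->|]; rewrite // !scale0r.
Qed.

Lemma lam_const_dT i v : dT A i *: lam (i0 v) = 0.
Proof. by rewrite -linearZ /= const_dT raddf0. Qed.

Definition in_T (x : G) := exists z : 'I_l -> G, x = \sum_i dT A i *: z i.

Lemma in_T0 : in_T 0.
Proof. by exists (fun=> 0); rewrite big1 // => i _; rewrite scaler0. Qed.
Lemma in_TD x y : in_T x -> in_T y -> in_T (x + y).
Proof.
move=> [z ->] [z' ->]; exists (fun i => z i + z' i).
by rewrite -big_split; apply: eq_bigr => i _; rewrite scalerDr.
Qed.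
Lemma in_T_op d x : (forall i, d * dT A i = dT A i * d) -> in_T x -> in_T (d *: x).
Proof.
move=> H [z ->]; exists (fun i => d *: z i); rewrite scaler_sumr.
by apply: eq_bigr => i _; rewrite !scalerA H.
Qed.
Lemma in_TN x : in_T x -> in_T (- x).
Proof.
by move=> H; rewrite -scaleN1r; apply: in_T_op H => i; rewrite mulN1r mulrN1.
Qed.
Lemma in_T_dT i x : in_T (dT A i *: x).
Proof.
exists (fun j => if j == i then x else 0).
rewrite (bigD1 i) //= eqxx big1 ?addr0 // => j /negbTE ->; exact: scaler0.
Qed.

Definition natinv k : diffop At := mulop ((k%:R^-1 : K)%:A).

Lemma natinvK k (H : lmodType (diffop At)) (x : H) :
  natinv k.+1 *: (k.+1%:R *: x) = x.
Proof.
by rewrite scalerA -mulop_nat /natinv -mulopM (natinv_mul charK) mulop1 scale1r.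
Qed.

Lemma natinv_comm k d : natinv k * d = d * natinv k.
Proof. exact: mulop_scalar_comm. Qed.

(* A class with a pole of order at least two along [t_i = f_i] is a derivative. *)
Lemma pole_dT (i : 'I_l) w v : exists k, pole i (polew w (delta0 v)) =
  dT A i *: (- natinv k *: polew w (delta0 v)).
Proof.
(* The pole order of [polew w (delta0 v)] along t_i = f_i: one for each i in w and one from
   [delta0]. Being positive, it is invertible in K. *)
exists (count_mem i w).+1.
have := dT_polew i (w ++ index_enum 'I_l) (lam (i0 v)).
rewrite lam_const_dT polew0 sub0r count_cat.
rewrite (count_uniq_mem _ (index_enum_uniq _)) mem_index_enum addn1.
rewrite /polew !foldr_cat -![foldr pole _ _]/(polew _ _) -delta0E => E.
by rewrite scaleNr scalerN scalerA -natinv_comm -scalerA E scalerN opprK natinvK.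
Qed.

(** By [pole_dT] every pole beyond those of [delta0] is a derivative up to a rational factor, so
    induction on w leads back to the classes delta(v). *)
Lemma gen_polew (Y : set G) : (forall v, Y (delta v)) ->
  (forall i x, Y x -> Y (dT A i *: x)) ->
  (forall c x, Y x -> Y (mulop ((c : K)%:A) *: x)) ->
  forall w v, Y (pi (polew w (delta0 v))).
Proof.
move=> Yd YT Yc; elim=> [|i w IH] v /=; first exact: Yd.
have [k ->] := pole_dT i w v; rewrite !linearZ; apply: (YT).
rewrite -mulopN -scaleNr; exact: Yc.
Qed.

End GraphModule.

(** * Generation by derivatives of delta classes *)

Section GraphModule2.
Variables (K : fieldType) (charK : [pchar K] =i pred0) (A : comAlgType K).
Variables (l : nat) (f : 'I_l -> A) (M : lmodType (diffop A)).
Variable (G : graph_module f M).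
Local Notation At := (polyext A l).
Local Notation Q := (gm_poly G).
Local Notation Qh := (gm_loc G).
Local Notation i0 := (gm_const G).
Local Notation lam := (gm_lambda G).
Local Notation pi := (gm_pi G).
Local Notation delta := (@delta K A l f M G).
Local Notation delta0 := (@delta0 K A l f M G).
Local Notation P i := (mulop (graph_eq f i)).
Local Notation h := (\prod_i graph_eq f i).
Local Notation in_T := (@in_T K A l f M G).

Lemma scalarE (c : K) : (c%:A : At) = tconst l (c%:A).
Proof.
by apply: polyext_ext => b; rewrite scaleE mcoeff1 mcoeffC mulr_algl.
Qed.

Lemma tconst1 : tconst l (1 : A) = 1. Proof. exact: mpolyC1. Qed.
Lemma tconstN (a : A) : tconst l (- a) = - tconst l a.
Proof. exact: (@mpolyCN l A). Qed.

Lemma tconst_nat k : tconst l (k%:R : A) = k%:R.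
Proof. exact: (@mpolyC_nat l A). Qed.

Lemma op_polew_comm d w (y : Qh) : (forall i, P i * d = d * P i) ->
  d *: polew w y = polew w (d *: y).
Proof. by move=> H; elim: w => //= i w IH; rewrite op_pole_comm ?IH. Qed.

Lemma delta_tconst a v : mulop (tconst l a) *: delta v = delta (mulop a *: v).
Proof.
rewrite /delta -linearZ /= !delta0E op_polew_comm => [|i]; last exact: mulop_comm.
by rewrite -linearZ /= -liftop_mulop const_lift.
Qed.

Lemma delta_P i v : P i *: delta v = 0.
Proof.
have [_ _ H] := gm_cohP G.
rewrite -linearZ /=; apply/H.
exists (fun j => if j == i then P i *: delta0 v else 0); split.
  by rewrite (bigD1 i) //= eqxx big1 ?addr0 // => j /negbTE ->.
move=> j; case: eqP => [->|_].
  exists 1%N, (i0 v); rewrite expr1 scalerA -mulopM mulrC.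
  by rewrite -prod_graph_eqE hinvK.
by exists 0%N, 0; rewrite scaler0 raddf0.
Qed.

Lemma delta_mT i v : mT A i *: delta v = delta (mulop (f i) *: v).
Proof.
have -> : mT A i = P i + mulop (tconst l (f i)).
  by rewrite -mulopD subrK.
by rewrite scalerDl delta_P add0r delta_tconst.
Qed.

(** The span of all dT^b delta(v), in impredicative form so as to serve directly as an induction
    principle; zero is included as delta(0). *)
Definition dT_span (x : G) := forall Y : set G,
  (forall x y, Y x -> Y y -> Y (x + y)) -> (forall v, Y (delta v)) ->
  (forall i x, Y x -> Y (dT A i *: x)) -> Y x.

Lemma dT_spanD x y : dT_span x -> dT_span y -> dT_span (x + y).
Proof. by move=> gx gy Y YD Yd YT; apply: (YD); [apply: (gx Y)|apply: (gy Y)]. Qed.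
Lemma dT_span_delta v : dT_span (delta v).
Proof. by move=> Y YD Yd YT. Qed.
Lemma dT_span_dT i x : dT_span x -> dT_span (dT A i *: x).
Proof. by move=> gx Y YD Yd YT; apply: (YT); apply: (gx Y). Qed.
Lemma dT_span_tconst a x : dT_span x -> dT_span (mulop (tconst l a) *: x).
Proof.
move=> gx; apply: (gx (fun x => dT_span (mulop (tconst l a) *: x))) => [y z gy gz|v|i y gy].
- by rewrite scalerDr; apply: dT_spanD.
- by rewrite delta_tconst; apply: dT_span_delta.
- by rewrite scalerA -liftop_mulop liftop_dT -scalerA liftop_mulop; apply: dT_span_dT.
Qed.
(** From t_i dT_j = dT_j t_i - [i = j] and t_i delta(v) = delta(f_i v). The induction carries
    [dT_span x] along, because the commutator gives back the element itself. *)
Lemma dT_span_mT i x : dT_span x -> dT_span (mT A i *: x).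
Proof.
move=> gx; suff: dT_span x /\ dT_span (mT A i *: x) by case.
apply: (gx (fun x => dT_span x /\ dT_span (mT A i *: x))) => [y z [gy gty] [gz gtz]|v|j y [gy gty]].
- by rewrite scalerDr; split; apply: dT_spanD.
- by rewrite delta_mT; split; apply: dT_span_delta.
- split; first exact: dT_span_dT.
  have -> : mT A i *: (dT A j *: y) = dT A j *: (mT A i *: y)
      + mulop (tconst l (- (j == i)%:R)) *: y.
    have E : (j == i)%:R + mulop (tconst l (- (j == i)%:R)) = 0 :> diffop At.
      by rewrite -mulop_nat -mulopD tconstN tconst_nat subrr mulop0.
    by rewrite !scalerA dT_mT scalerDl -addrA -scalerDl E scale0r addr0.
  by apply: dT_spanD; [apply: dT_span_dT|apply: dT_span_tconst].
Qed.
Lemma dT_span_tmono b x : dT_span x -> dT_span (mulop (tmono A b) *: x).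
Proof.
elim/mnm_ind: b x => [|i b IH] x gx; first by rewrite tmono0 mulop1 scale1r.
by rewrite tmonoS mulopM -scalerA; exact: (@dT_span_mT i _ (IH _ gx)).
Qed.

(** A class in M' is represented by a sum of fractions t^b v_b / h^k. Poles are traded for
    derivatives by [gen_polew], and the span is stable under t^b. *)
Lemma dT_span_full x : dT_span x.
Proof.
have gw w v : dT_span (pi (polew w (delta0 v))).
  apply: (gen_polew charK) => [|i y|c y]; [exact: dT_span_delta|exact: dT_span_dT|].
  by rewrite scalarE; apply: dT_span_tconst.
have [[_ H2 H3] H _] := gm_cohP G; have [y <-] := H x.
(* One more factor h is put into the numerator, so that the exponent [k.+1] of the denominator is
   positive and each term is a further quotient of some [delta0]. *)
have [k [q E0]] := H2 y.
have [Hs _ _] := gm_polyP G; have [s [c Eq]] := Hs (mulop h *: q).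
have {q Eq E0} E : mulop (h ^+ k.+1) *: y = lam (\sum_(b <- s) mulop (tmono A b) *: i0 (c b)).
  by rewrite -Eq linearZ /= -E0 scalerA -mulopM -exprS.
have -> : y = \sum_(b <- s) mulop (tmono A b) *: iter k.+1 (@hinv _ _ _ _ _ G) (lam (i0 (c b))).
  have lamE : lam (\sum_(b <- s) mulop (tmono A b) *: i0 (c b)) =
      \sum_(b <- s) mulop (tmono A b) *: lam (i0 (c b)).
    by rewrite linear_sum; apply: eq_bigr => b _; rewrite linearZ.
  move: E; rewrite lamE.
  elim: k.+1 y {H2 x} => [|k' IH] y; first by rewrite expr0 mulop1 scale1r.
  rewrite exprSr mulopM -scalerA => /IH E.
  apply: (@h_inj _ _ _ _ _ G); rewrite E scaler_sumr; apply: eq_bigr => b _.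
  by rewrite [RHS]scalerA mulop_comm -scalerA hinvK.
have g0 : dT_span 0 by rewrite -(delta_0 G); apply: dT_span_delta.
have gh z : (forall w, dT_span (pi (polew w z))) -> forall w, dT_span (pi (polew w (hinv z))).
  move=> Hz w; have := Hz (w ++ index_enum 'I_l).
  by rewrite /polew foldr_cat -![foldr _ z _]/(polew _ z) polew_enum.
rewrite linear_sum; apply: (big_ind dT_span) => // [|b _]; first exact: dT_spanD.
rewrite linearZ; apply: dT_span_tmono; rewrite iterSr.
suff : forall w, dT_span (pi (polew w (iter k (@hinv _ _ _ _ _ G) (delta0 (c b))))).
  by move/(_ [::]).
by elim: k {E} => [|k IH] //= w; apply: gh.
Qed.

Lemma gm_ind (Y : set G) :
  (forall x y, Y x -> Y y -> Y (x + y)) -> (forall v, Y (delta v)) ->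
  (forall i x, Y x -> Y (dT A i *: x)) -> forall x, Y x.
Proof. by move=> YD Yd YT x; apply: (dT_span_full x). Qed.

(** Fractions with strictly more poles than w. When w lists all graph equations, [pole_dT] makes
    their classes in M' derivatives, hence zero modulo [in_T]. *)
Let Jplus w : set Qh :=
  [set y | exists w' v, w' <> [::] /\ y = polew w' (polew w (lam (i0 v)))].

Lemma addspan0 (T : nmodType) (X : set T) : addspan X 0.
Proof. by move=> Y. Qed.
Lemma addspanD (T : nmodType) (X : set T) x y :
  addspan X x -> addspan X y -> addspan X (x + y).
Proof. by move=> Hx Hy Y Y0 YD XY; apply: (YD); [apply: (Hx Y)|apply: (Hy Y)]. Qed.
Lemma addspan_sub (T : nmodType) (X : set T) x : X x -> addspan X x.
Proof. by move=> Xx Y _ _; apply. Qed.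

Lemma addspan_pole i w y :
  addspan (Jplus w) y -> addspan (Jplus (i :: w)) (pole i y).
Proof.
move=> H; apply: (H (fun y => addspan (Jplus (i :: w)) (pole i y))) => [|a b|_ [w' [v [Hw ->]]]].
- by rewrite pole0; apply: addspan0.
- by rewrite /= poleD; apply: addspanD.
- by apply: addspan_sub; exists w', v; split=> //; rewrite polew_comm.
Qed.

(** Moving e past 1/(t_i - f_i) costs a term with the bracket [e, f_i] and one more pole. The
    induction on the order handles that term for all words at once; the inner induction on w handles
    the rest. *)
Lemma liftop_polew k e : order_lt k e -> forall w v,
  addspan (Jplus w) (liftop l e *: polew w (lam (i0 v)) - polew w (lam (i0 (e *: v)))).
Proof.
elim: k e => [|k IHk] e ek.
  move=> w v; rewrite [e]ek liftop0 !scale0r !raddf0 polew0 subrr; exact: addspan0.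
elim=> [|i w IHw] v /=.
  by rewrite -linearZ /= const_lift subrr; apply: addspan0.
rewrite op_pole addrAC -poleN; apply: addspanD.
  rewrite -poleD; exact (@addspan_pole i w _ (IHw v)).
set y := polew w _.
have -> : P i * liftop l e - liftop l e * P i = liftop l (bracket e (f i)).
  by rewrite liftop_P opprB addrC subrK.
have adk := order_lt_bracket (f i) ek.
have -> : liftop l (bracket e (f i)) *: pole i y =
    (liftop l (bracket e (f i)) *: polew (i :: w) (lam (i0 v))
      - polew (i :: w) (lam (i0 (bracket e (f i) *: v))))
    + polew (i :: w) (lam (i0 (bracket e (f i) *: v))) by rewrite subrK.
rewrite poleD; apply: addspanD.
  apply: (IHk _ adk (i :: w) v (fun y => addspan (Jplus (i :: w)) (pole i y))) => [|a b|_ [w' [v' [Hw ->]]]].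
  - by rewrite /= pole0; apply: addspan0.
  - by rewrite /= poleD; apply: addspanD.
  - by apply: addspan_sub; exists (i :: w'), v'.
by apply: addspan_sub; exists [:: i], (bracket e (f i) *: v).
Qed.

Lemma liftop_delta e v : in_T (liftop l e *: delta v - delta (e *: v)).
Proof.
have [k ek] := orderP e.
rewrite /delta -linearZ -raddfB /= !delta0E.
apply: (@liftop_polew k.+1 e ek (index_enum 'I_l) v (fun y => in_T (pi y))) => [|a b|_ [[|i w] [v' [w0 ->]]]].
- by rewrite /= raddf0; apply: in_T0.
- by rewrite /= raddfD; apply: in_TD.
- by [].
- rewrite /= -delta0E; have [k' ->] := pole_dT charK G i w v'.
  by rewrite linearZ; apply: in_T_dT.
Qed.

End GraphModule2.

(** * Coefficients of elements of M[t] *)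

Section Coefficients.
Variables (K : fieldType) (A : comAlgType K) (l : nat).
Variables (M : lmodType (diffop A)) (Q : lmodType (diffop (polyext A l))).
Variables (i0 : {additive M -> Q}) (QP : is_poly_module i0).
Local Notation At := (polyext A l).

Lemma big_supp (V : nmodType) (I : eqType) (s s' : seq I) (F : I -> V) :
  uniq s -> uniq s' -> {subset s <= s'} -> (forall b, b \notin s -> F b = 0) ->
  \sum_(b <- s') F b = \sum_(b <- s) F b.
Proof.
move=> us us' ss F0; rewrite (bigID (mem s)) /= [X in _ + X]big1 ?addr0 //.
rewrite -big_filter; apply: perm_big; apply: uniq_perm => //.
  exact: filter_uniq.
by move=> b; rewrite mem_filter; apply/andP/idP => [[]//|bs]; split; last exact: ss.
Qed.

(** Normalized expansions. As the coefficients vanish off the list, the list can be enlarged freely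
    and two expansions compared on a common one. *)
Let nrep (q : Q) s c := [/\ uniq s, q = \sum_(b <- s) mulop (tmono A b) *: i0 (c b)
  & forall b, b \notin s -> c b = 0].

Lemma nrep_ext q s s' c : nrep q s c -> uniq s' -> {subset s <= s'} -> nrep q s' c.
Proof.
move=> [us -> c0] us' ss; split=> // [|b bs'].
  apply/esym/big_supp => // b /c0 ->; by rewrite raddf0 scaler0.
by apply: c0; apply: contra bs' => /ss.
Qed.

Lemma nrep_common q q' s s' c c' : nrep q s c -> nrep q' s' c' ->
  exists s'', nrep q s'' c /\ nrep q' s'' c'.
Proof.
move=> H H'; exists (undup (s ++ s')); split.
- apply: (nrep_ext H); rewrite ?undup_uniq // => b bs.
  by rewrite mem_undup mem_cat bs.
- apply: (nrep_ext H'); rewrite ?undup_uniq // => b bs.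
  by rewrite mem_undup mem_cat bs orbT.
Qed.

Lemma nrepD q q' s c c' : nrep q s c -> nrep q' s c' ->
  nrep (q + q') s (fun b => c b + c' b).
Proof.
move=> [us -> c0] [_ -> c0']; split=> // [|b bs]; last by rewrite c0 // c0' // addr0.
by rewrite -big_split; apply: eq_bigr => b _; rewrite raddfD scalerDr.
Qed.

Lemma nrep_mono b v : nrep (mulop (tmono A b) *: i0 v) [:: b]
  (fun b' => if b' == b then v else 0).
Proof.
split=> //; first by rewrite big_seq1 eqxx.
by move=> b'; rewrite inE => /negbTE ->.
Qed.

Lemma nrep_ex q : exists sc, nrep q sc.1 sc.2.
Proof.
have [H _ _] := QP; have [s [c ->]] := H q.
apply: (big_ind (fun q => exists sc, nrep q sc.1 sc.2)) => [|x y|b _].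
- by exists ([::], fun=> 0); split=> //=; rewrite big_nil.
- move=> [[s1 c1] /= H1] [[s2 c2] /= H2].
  have [s3 [H3 H4]] := nrep_common H1 H2.
  by exists (s3, fun b => c1 b + c2 b); apply: nrepD.
- by exists ([:: b], fun b' => if b' == b then c b else 0); apply: nrep_mono.
Qed.

Lemma nrep_uniq q s s' c c' : nrep q s c -> nrep q s' c' -> c =1 c'.
Proof.
move=> H H'; have [s'' [[us E c0] [_ E' c0']]] := nrep_common H H' => b.
case: (boolP (b \in s'')) => [bs|bs]; last by rewrite c0 ?c0'.
have [_ U _] := QP.
apply/eqP; rewrite -subr_eq0; apply/eqP.
apply: (U s'' (fun b => c b - c' b) us _ b bs).
under eq_bigr do rewrite raddfB scalerBr.
by rewrite sumrB -E -E' subrr.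
Qed.

(** The functional tensored with M. It serves to extract coefficients from M[t] after a change of
    coordinates. *)
Lemma poly_functional (kap : At -> A) :
  (forall p q, kap (p + q) = kap p + kap q) ->
  (forall a p, kap (tconst l a * p) = a * kap p) ->
  exists phi : Q -> M, (forall x y, phi (x + y) = phi x + phi y) /\
    forall p v, phi (mulop p *: i0 v) = mulop (kap p) *: v.
Proof.
move=> kD kC.
pose sc q := sval (cid (nrep_ex q)).
have scP q : nrep q (sc q).1 (sc q).2 by rewrite /sc; case: cid.
pose phi q := \sum_(b <- (sc q).1) mulop (kap (tmono A b)) *: (sc q).2 b.
have phiE q s c : nrep q s c -> phi q = \sum_(b <- s) mulop (kap (tmono A b)) *: c b.
  move=> H; have [s' [H1 H2]] := nrep_common H (scP q).
  have cc := nrep_uniq H (scP q).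
  have [us _ c0] := H; have [us' _ _] := H1.
  have [uq _ q0] := scP q.
  rewrite /phi; transitivity (\sum_(b <- undup ((sc q).1 ++ s)) mulop (kap (tmono A b)) *: (sc q).2 b).
    apply/esym/big_supp; rewrite ?undup_uniq //.
      by move=> b bs; rewrite mem_undup mem_cat bs.
    by move=> b bs; rewrite q0 ?scaler0.
  under eq_bigr do rewrite -cc.
  apply/big_supp; rewrite ?undup_uniq //.
    by move=> b bs; rewrite mem_undup mem_cat bs orbT.
  by move=> b bs; rewrite c0 ?scaler0.
have phiD x y : phi (x + y) = phi x + phi y.
  have [s [H1 H2]] := nrep_common (scP x) (scP y).
  rewrite (phiE _ _ _ H1) (phiE _ _ _ H2) (phiE _ _ _ (nrepD H1 H2)) -big_split.
  by apply: eq_bigr => b _; rewrite scalerDr.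
have phi0 : phi 0 = 0 by apply: (addIr (phi 0)); rewrite -phiD !add0r.
have kap0 : kap 0 = 0 by apply: (addIr (kap 0)); rewrite -kD !add0r.
exists phi; split=> // p v.
elim/polyext_ind: p => [|p q IHp IHq|b a].
- by rewrite kap0 !mulop0 !scale0r phi0.
- by rewrite kD !mulopD !scalerDl phiD IHp IHq.
- have [_ _ H] := QP.
  rewrite mulopM -scalerA -liftop_mulop (H _ [:: mnm0] (fun=> mulop a)); last first.
    by move=> a'; rewrite big_seq1 liftop_tconst tmono0 mul1r.
  rewrite big_seq1 tmono0 mulop1 scale1r (phiE _ _ _ (nrep_mono b _)) big_seq1 eqxx.
  by rewrite scalerA -mulopM [in RHS]mulrC kC mulrC.
Qed.

End Coefficients.

(** * Injectivity of delta *)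

Section DeltaInj.
Variables (K : fieldType) (A : comAlgType K).
Variables (l : nat) (f : 'I_l -> A) (M : lmodType (diffop A)).
Variable (G : graph_module f M).
Local Notation At := (polyext A l).
Local Notation Q := (gm_poly G).
Local Notation Qh := (gm_loc G).
Local Notation i0 := (gm_const G).
Local Notation lam := (gm_lambda G).
Local Notation pi := (gm_pi G).
Local Notation h := (\prod_i graph_eq f i).

Lemma coef_tvar_mul (i : 'I_l) n (p : At) (b : multinom l) : (b i < n)%N ->
  mcoeff b (tvar A i ^+ n * p) = 0.
Proof.
elim: n p b => // n IH p b bn; rewrite exprSr -mulrA.
elim/polyext_ind: p => [|p q IHp IHq|c a]; first by rewrite !mulr0 mcoeff0.
  by rewrite mulrDr mulrDr mcoeffD IHp IHq addr0.
have -> : tvar A i ^+ n * (tvar A i * (tmono A c * tconst l a)) =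
   tconst l a * mpolyX A (mnm_add (mnm_muln (mnm1 i) n.+1) c).
  rewrite mulrA -exprSr mulrA mulrC; congr (_ * _).
  by rewrite (mpolyXD A); congr (_ * _); rewrite (@mpolyXn l A).
rewrite mcoeffCM mcoeffX; case: eqP => [E|_]; last by rewrite mulr0.
by move: bn; rewrite -E mnmDE mulmnE mnm1E eqxx mul1n ltnNge leq_addr.
Qed.

(** The substitution t_i -> t_i + f_i, which carries the graph equations to the coordinates. *)
Let sub (p : At) : At := mmap (@mpolyC l A) (fun i => (tvar A i + tconst l (f i) : At)) p.

Lemma subM p q : sub (p * q) = sub p * sub q.
Proof. exact: (@rmorphM (mpoly l A) (mpoly l A) (mmap (@mpolyC l A) _)). Qed.
Lemma subD p q : sub (p + q) = sub p + sub q.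
Proof. exact: mmapD. Qed.
Lemma sub_tconst a : sub (tconst l a) = tconst l a.
Proof. exact: mmapC. Qed.
Lemma sub1 : sub 1 = 1.
Proof. by rewrite -(@tconst1 K A l) sub_tconst. Qed.
Lemma subXn p n : sub (p ^+ n) = sub p ^+ n.
Proof. by elim: n => [|n IH]; rewrite ?sub1 // !exprS subM IH. Qed.
Lemma sub_graph_eq i : sub (graph_eq f i) = tvar A i.
Proof.
have -> : graph_eq f i = tvar A i + tconst l (- f i) by rewrite tconstN.
rewrite subD sub_tconst.
have -> : sub (tvar A i) = tvar A i + tconst l (f i).
  rewrite /sub /tvar /Defs.tmono mmapX mmap1U //.
by rewrite tconstN addrK.
Qed.
Lemma sub_h : sub h = \prod_i tvar A i.
Proof.
by elim/big_rec2: _ => [|i x y _ <-]; [exact: sub1|rewrite subM sub_graph_eq].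
Qed.

Lemma coef_hX n : mcoeff (Multinom [tuple n | _ < l]) ((\prod_i tvar A i) ^+ n) = 1.
Proof.
have -> : (\prod_i tvar A i) ^+ n = mpolyX A (Multinom [tuple n | _ < l]).
  rewrite (@mpolyXE_id l A) -prodrXl; apply: eq_bigr => i _.
  by rewrite mnmE.
by rewrite mcoeffX eqxx.
Qed.

(** If the class of v/h vanishes, clearing denominators makes h^(N+n) v a combination of multiples
    of the (t_i - f_i)^(N+n+1). After the substitution [sub], the coefficient of (t_1 ... t_l)^(N+n)
    is v on one side and 0 on the other. *)
Lemma delta_inj v : delta G v = 0 -> v = 0.
Proof.
have [[hb H2 H3] _ H] := gm_cohP G => /H [z [Ez zP]].
have /choice [k /choice [q qP]] := zP.
pose N := \max_i k i.
pose h' i := \prod_(j | j != i) graph_eq f j.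
have lamE : lam (mulop (h ^+ N) *: i0 v -
   \sum_i mulop (graph_eq f i ^+ N.+1 * h' i) *: (mulop (h' i ^+ (N - k i)) *: q i)) = 0.
  rewrite linearB linear_sum linearZ /=; apply/eqP; rewrite subr_eq0; apply/eqP.
  rewrite -[lam (i0 v)]hinvK -/(delta0 G v) scalerA -mulopM -exprSr Ez scaler_sumr.
  apply: eq_bigr => i _; rewrite !linearZ /= -qP !scalerA -!mulopM.
  congr (mulop _ *: _); rewrite -mulrA -mulrA -exprD subnK ?leq_bigmax //.
  by rewrite -exprS (prod_graph_eqE f i) exprMn.
have [n] := H3 _ lamE.
rewrite scalerBr => /eqP; rewrite subr_eq0 => /eqP.
pose kap (p : At) : A := mcoeff (Multinom [tuple (N + n)%N | _ < l]) (sub p).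
have kD p p' : kap (p + p') = kap p + kap p' by rewrite /kap subD mcoeffD.
have kC a p : kap (tconst l a * p) = a * kap p.
  by rewrite /kap subM sub_tconst mcoeffCM.
have [phi [phiD phiE]] := poly_functional (gm_polyP G) kD kC.
have phi0 : phi 0 = 0 by apply: (addIr (phi 0)); rewrite -phiD !add0r.
move=> /(congr1 phi); rewrite scalerA -mulopM -exprD addnC phiE.
rewrite /kap subXn sub_h coef_hX mulop1 scale1r => ->.
rewrite scaler_sumr; apply: (big_ind (fun x => phi x = 0)) => //.
  by move=> x y Hx Hy; rewrite phiD Hx Hy addr0.
move=> i _; rewrite !scalerA -!mulopM.
have [Hs _ _] := gm_polyP G; have [s [c ->]] := Hs (q i).
rewrite scaler_sumr; apply: (big_ind (fun x => phi x = 0)) => //.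
  by move=> x y Hx Hy; rewrite phiD Hx Hy addr0.
move=> b _; rewrite scalerA -mulopM phiE /kap.
set x := _ * tmono A b.
have -> : x = graph_eq f i ^+ (N + n).+1 * (h' i ^+ n.+1 * h' i ^+ (N - k i) * tmono A b).
  rewrite /x (prod_graph_eqE f i) -/(h' i); move: (graph_eq f i) (h' i) (h' i ^+ _) => y y' y''.
  rewrite exprMn -addSn exprD [y' ^+ n.+1]exprS.
  by move: (y ^+ n) (y ^+ N.+1) (y' ^+ n) => z1 z2 z3; ring.
by rewrite subM subXn sub_graph_eq coef_tvar_mul ?mnmE // mulop0 scale0r.
Qed.

End DeltaInj.

(** * The operator counting derivatives of delta *)

Section Theta.
Variables (K : fieldType) (charK : [pchar K] =i pred0) (A : comAlgType K).
Variables (l : nat) (f : 'I_l -> A) (M : lmodType (diffop A)).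
Variable (G : graph_module f M).
Local Notation At := (polyext A l).
Local Notation delta := (@delta K A l f M G).
Local Notation P i := (mulop (graph_eq f i)).
Local Notation in_T := (@in_T K A l f M G).

Lemma mod_div (B : comAlgType K) (V : lmodType (diffop B)) k (x : V) :
  exists y, x = y *+ k.+1.
Proof.
exists (mulop ((k.+1%:R^-1 : K)%:A) *: x).
by rewrite -scaler_nat scalerA -mulop_nat -mulopM mulrC (natinv_mul charK) mulop1 scale1r.
Qed.

Lemma mod_char0 (B : comAlgType K) (V : lmodType (diffop B)) k (x : V) :
  x *+ k.+1 = 0 -> x = 0.
Proof.
move=> E; suff <- : mulop ((k.+1%:R^-1 : K)%:A) *: (x *+ k.+1) = x by rewrite E scaler0.
by rewrite -scaler_nat scalerA -mulop_nat -mulopM (natinv_mul charK) mulop1 scale1r.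
Qed.

Lemma sum_eqR (R : pzRingType) m (F : 'I_m -> R) i : \sum_j F j * (i == j)%:R = F i.
Proof.
rewrite (bigD1 i) //= eqxx mulr1 big1 ?addr0 // => j.
by rewrite eq_sym => /negbTE ->; rewrite mulr0.
Qed.

(* Acts on [dT^w (delta v)] as multiplication by [|w|]. *)
Definition Theta : diffop At := - \sum_i dT A i * P i.

Lemma Theta_dT i : Theta * dT A i = dT A i * (Theta + 1).
Proof.
have -> : Theta * dT A i = - \sum_j (dT A i * (dT A j * P j) - dT A j * (i == j)%:R).
  rewrite /Theta mulNr mulr_suml; congr (- _); apply: eq_bigr => j _.
  rewrite mulrA [dT A i * dT A j]dT_comm -!mulrA -mulrBr; congr (_ * _).
  by rewrite dT_P addrK.
by rewrite sumrB sum_eqR opprB addrC -mulr_sumr mulrDr mulr1 mulrN.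
Qed.

Lemma P_Theta i : P i * Theta = (Theta + 1) * P i.
Proof.
have -> : P i * Theta = - \sum_j (dT A j * P j * P i - P j * (i == j)%:R).
  rewrite /Theta mulrN mulr_sumr; congr (- _); apply: eq_bigr => j _.
  rewrite mulrA; have -> : P i * dT A j = dT A j * P i - (j == i)%:R by rewrite dT_P addrK.
  rewrite mulrBl -!mulrA [P j * P i]mulop_comm [j == i]eq_sym.
  by rewrite natr_comm.
by rewrite sumrB sum_eqR opprB addrC -mulr_suml mulrDl mul1r mulNr.
Qed.

Lemma Theta_delta v : Theta *: delta v = 0.
Proof.
rewrite scaleNr scaler_suml big1 ?oppr0 // => i _.
by rewrite -scalerA delta_P scaler0.
Qed.

(** The product (Theta - n) ... (Theta - 1) kills dT^w delta(v) for 1 <= |w| <= n and multiplies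
    delta(v) by (-1)^n n!. On sums of such terms with |w| <= n it is, up to a nonzero scalar, the
    projection onto delta(M). *)
Fixpoint Tprod n : diffop At :=
  if n is n'.+1 then (Theta - n%:R) * Tprod n' else 1.

Lemma TprodSr n : Tprod n.+1 = Tprod n * (Theta - n.+1%:R).
Proof.
have C k k' : (Theta - k%:R) * (Theta - k'%:R) = (Theta - k'%:R) * (Theta - k%:R).
  have Ck n' (x : diffop At) : GRing.comm x n'%:R by exact: commr_nat.
  by apply: commrB => //; apply/commr_sym/commrB => //; apply/commr_refl.
suff H k : Tprod n * (Theta - k%:R) = (Theta - k%:R) * Tprod n by rewrite H.
by elim: n k => [|n IH] k /=; rewrite ?mul1r ?mulr1 // -mulrA IH !mulrA C.
Qed.


(** Passing dT_i raises Theta by one, so the factor Theta - 1 becomes Theta, which kills every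
    delta(v). *)
Lemma Tprod_dT n i : Tprod n.+1 * dT A i = dT A i * (Theta * Tprod n).
Proof.
elim: n => [|n IH].
  by rewrite /= !mulr1 mulrBl Theta_dT mul1r mulrDr mulr1 addrK.
rewrite [Tprod n.+2]/= -mulrA IH mulrA mulrBl Theta_dT -natr_comm -mulrBr.
rewrite -!mulrA; congr (_ * _); rewrite [n.+2%:R]mulrSr opprD addrA.
rewrite addrAC addrK [Tprod n.+1]/= !mulrA; congr (_ * _).
by rewrite mulrBl mulrBr natr_comm.
Qed.

Lemma P_Tprod n i : P i * Tprod n.+1 = Theta * Tprod n * P i.
Proof.
elim: n => [|n IH].
  by rewrite /= !mulr1 mulrBr P_Theta mulr1 mulrDl mul1r addrK.
have E : P i * (Theta - n.+2%:R) = (Theta - n.+1%:R) * P i.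
  rewrite mulrBr P_Theta natr_comm -mulrBl [n.+2%:R]mulrSr opprD addrA.
  by rewrite [_ + 1 - _]addrAC addrK.
rewrite -[Tprod n.+2]/((Theta - n.+2%:R) * Tprod n.+1) mulrA E -[LHS]mulrA IH.
rewrite -[Tprod n.+1]/((Theta - n.+1%:R) * Tprod n) !mulrA; congr (_ * _ * _).
by rewrite mulrBl mulrBr natr_comm.
Qed.

Lemma Tprod_delta n v : exists w, Tprod n *: delta v = delta w.
Proof.
elim: n v => [|n IH] v; first by exists v; rewrite scale1r.
have [w E] := IH (- (v *+ n.+1)); exists w; rewrite -E TprodSr -scalerA; congr (_ *: _).
rewrite scalerBl Theta_delta sub0r deltaN scaler_nat; congr (- _).
by elim: n.+1 => [|k IHk]; rewrite ?delta_0 // !mulrS IHk deltaD.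
Qed.

Lemma Tprod_delta_inj n v : Tprod n *: delta v = 0 -> v = 0.
Proof.
elim: n v => [|n IH] v; first by rewrite scale1r => /delta_inj.
rewrite TprodSr -scalerA scalerBl Theta_delta sub0r scaler_nat -mulNrn.
have -> : (- delta v) *+ n.+1 = delta (- v *+ n.+1).
  by rewrite -deltaN; elim: n.+1 => [|k IHk]; rewrite ?delta_0 // !mulrS IHk deltaD.
by move/IH/mod_char0/eqP; rewrite oppr_eq0 => /eqP.
Qed.

(** Once n exceeds the number of derivatives in x, only the delta component survives. The claim is
    made for all larger n' so that sums can be handled by a maximum. *)
Lemma Tprod_ex x : exists n, forall n', (n <= n')%N -> exists v, Tprod n' *: x = delta v.
Proof.
move: x; apply: (gm_ind charK) => [x y [n Hx] [n' Hy]|v|i x [n Hx]].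
- exists (maxn n n') => n''; rewrite geq_max => /andP[/Hx [v E] /Hy [w E']].
  by exists (v + w); rewrite scalerDr E E' deltaD.
- by exists 0%N => n _; apply: Tprod_delta.
- exists n.+1 => -[//|n'] /Hx [v E]; exists 0.
  by rewrite scalerA Tprod_dT -!scalerA E Theta_delta scaler0 delta_0.
Qed.

Lemma Tprod_T x : in_T x -> exists n, forall n', (n <= n')%N -> Tprod n' *: x = 0.
Proof.
move=> [z ->]; apply: (big_ind (fun x : G => exists n, forall n', (n <= n')%N -> Tprod n' *: x = 0)).
- by exists 0%N => n _; rewrite scaler0.
- move=> a b [n Hx] [n' Hy].
  exists (maxn n n') => n''; rewrite geq_max => /andP[/Hx E /Hy E'].
  by rewrite scalerDr E E' addr0.
- move=> i _; have [n H] := Tprod_ex (z i).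
  exists n.+1 => -[//|n'] /H [v E].
  by rewrite scalerA Tprod_dT -!scalerA E Theta_delta scaler0.
Qed.

(** For large n, [Tprod n] kills a given element of sum_i dT_i M' but acts on delta(v) by the
    invertible factor (-1)^n n!. *)
Lemma delta_T v : in_T (delta v) -> v = 0.
Proof. by move/Tprod_T => [n /(_ n (leqnn n)) /Tprod_delta_inj]. Qed.

(** On the kernel of Theta, [Tprod n] is multiplication by (-1)^n n!, and for large n it sends x
    into delta(M). The integer factors are divided out one at a time. *)
Lemma Theta_ker x : Theta *: x = 0 -> exists v, x = delta v.
Proof.
move=> Tx; have [n /(_ n (leqnn n)) [v]] := Tprod_ex x.
elim: n v => [|n IH] v; first by rewrite scale1r => ->; exists v.
rewrite TprodSr -scalerA scalerBl Tx sub0r scalerN scaler_nat => E.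
have [w Ew] := mod_div n (- v); apply: (IH w).
apply/eqP; rewrite -subr_eq0; apply/eqP/(@mod_char0 _ _ n).
rewrite mulrnBl scalerMnr -[X in X - _]opprK E -deltaN Ew.
have -> : delta (w *+ n.+1) = delta w *+ n.+1.
  by elim: n.+1 => [|k IHk]; rewrite ?delta_0 // !mulrS deltaD IHk.
exact: subrr.
Qed.

End Theta.

(** * Projection to M and moments *)

Section Rho.
Variables (K : fieldType) (charK : [pchar K] =i pred0) (A : comAlgType K).
Variables (l : nat) (f : 'I_l -> A) (M : lmodType (diffop A)).
Variable (G : graph_module f M).
Local Notation At := (polyext A l).
Local Notation delta := (@delta K A l f M G).
Local Notation P i := (mulop (graph_eq f i)).
Local Notation in_T := (@in_T K A l f M G).

(** Existence in the decomposition M' = delta(M) + sum_i dT_i M'; [delta_T] shows that the sum is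
    direct, whence [rho]. *)
Lemma rho_ex x : exists v, in_T (x - delta v).
Proof.
move: x; apply: (gm_ind charK) => [x y [v Hx] [w Hy]|v|i x _].
- by exists (v + w); rewrite deltaD opprD addrACA; apply: in_TD.
- by exists v; rewrite subrr; apply: in_T0.
- by exists 0; rewrite delta_0 subr0; apply: in_T_dT.
Qed.

Definition rho x := sval (cid (rho_ex x)).

Lemma rhoP x : in_T (x - delta (rho x)).
Proof. by rewrite /rho; case: cid. Qed.

Lemma rhoE x v : in_T (x - delta v) -> rho x = v.
Proof.
move=> H; apply/eqP; rewrite -subr_eq0; apply/eqP/(delta_T charK (G := G)).
rewrite deltaD deltaN.
have -> : delta (rho x) - delta v = (x - delta v) - (x - delta (rho x)).
  by rewrite [RHS]addrC opprB addrA subrK.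
by apply: in_TD => //; apply: in_TN; apply: rhoP.
Qed.

Lemma rhoD x y : rho (x + y) = rho x + rho y.
Proof.
by apply: rhoE; rewrite deltaD opprD addrACA; apply: in_TD; apply: rhoP.
Qed.

Lemma rho_delta v : rho (delta v) = v.
Proof. by apply: rhoE; rewrite subrr; apply: in_T0. Qed.

Lemma rho0 : rho 0 = 0.
Proof. by rewrite -(delta_0 G) rho_delta. Qed.

Lemma rhoN x : rho (- x) = - rho x.
Proof. by apply/eqP; rewrite -addr_eq0 -rhoD addNr rho0. Qed.

Lemma rho_T x : in_T x -> rho x = 0.
Proof. by move=> H; apply: rhoE; rewrite delta_0 subr0. Qed.

Lemma rho_dT i x : rho (dT A i *: x) = 0.
Proof. exact/rho_T/in_T_dT. Qed.

(** [liftop l e] commutes with each dT_i, hence preserves sum_i dT_i M', and modulo this sum it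
    sends delta(v) to delta(e v). *)
Lemma rho_lift e x : rho (liftop l e *: x) = e *: rho x.
Proof.
apply: rhoE.
have -> : liftop l e *: x - delta (e *: rho x) =
    liftop l e *: (x - delta (rho x)) + (liftop l e *: delta (rho x) - delta (e *: rho x)).
  by rewrite scalerBr addrA subrK.
apply: in_TD; last exact: liftop_delta.
by apply: in_T_op; [move=> i; exact: liftop_dT|exact: rhoP].
Qed.

Definition mTw (w : seq 'I_l) : diffop At := \prod_(i <- w) mT A i.

Lemma mTw_nil : mTw [::] = 1. Proof. exact: big_nil. Qed.
Lemma mTw_cons i w : mTw (i :: w) = mT A i * mTw w. Proof. exact: big_cons. Qed.
Lemma mTw_comm b w : mulop b * mTw w = mTw w * mulop b.
Proof.
elim: w => [|i w IH]; first by rewrite mTw_nil mulr1 mul1r.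
by rewrite mTw_cons mulrA [mulop b * _]mulop_comm -!mulrA IH.
Qed.
Lemma mTw_lift e w : liftop l e * mTw w = mTw w * liftop l e.
Proof.
elim: w => [|i w IH]; first by rewrite mTw_nil mulr1 mul1r.
by rewrite mTw_cons mulrA liftop_mT -!mulrA IH.
Qed.

Lemma rho_Tprod n x : rho x = 0 -> rho (Tprod f n *: x) = 0.
Proof.
move=> r0; elim: n => [|n IH] /=; first by rewrite scale1r.
rewrite -scalerA scalerBl rhoD rhoN scaler_nat.
have -> : rho (Theta f *: (Tprod f n *: x)) = 0.
  apply: rho_T; rewrite scaleNr; apply: in_TN; rewrite scaler_suml.
  by eexists; apply: eq_bigr => i _; rewrite -[LHS]scalerA.
elim: n.+1 => [|k IHk]; first by rewrite mulr0n rho0 subr0.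
by rewrite mulrS rhoD IH [0 + rho _]add0r.
Qed.

(** Vanishing of all moments passes from y to (t_i - f_i) y, and [P_Tprod] trades a factor of
    [Tprod] for this multiplication. Induction on n with Tprod n y = 0 thus gives (t_i - f_i) y = 0
    for all i; then Theta kills y, so y = delta(rho y) = 0. *)
Lemma rho_inj x : (forall w, rho (mTw w *: x) = 0) -> x = 0.
Proof.
have X0P (y : G) i : (forall w, rho (mTw w *: y) = 0) ->
    forall w, rho (mTw w *: (P i *: y)) = 0.
  move=> H w; rewrite graph_eqE scalerBl scalerBr rhoD rhoN.
  rewrite [mTw w *: (liftop _ _ *: _)]scalerA -mTw_lift -scalerA rho_lift H scaler0 subr0 scalerA.
  by rewrite -[mTw w * mT A i]mTw_comm -mTw_cons.
have r0 (y : G) : (forall w, rho (mTw w *: y) = 0) -> rho y = 0.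
  by move/(_ [::]); rewrite mTw_nil scale1r.
have key n (y : G) : (forall w, rho (mTw w *: y) = 0) -> Tprod f n *: y = 0 -> y = 0.
  elim: n y => [|n IH] y H; first by rewrite scale1r.
  move=> E; have Py i : P i *: y = 0.
    apply: IH; first exact: X0P.
    have [|v Ev] := @Theta_ker K charK A l f M G (Tprod f n *: (P i *: y)).
      by rewrite !scalerA -P_Tprod -scalerA E scaler0.
    have := rho_Tprod n (r0 _ (X0P y i H)); rewrite Ev rho_delta => ->.
    exact: delta_0.
  have [|v Ev] := @Theta_ker K charK A l f M G y.
    by rewrite scaleNr scaler_suml big1 ?oppr0 // => i _; rewrite -scalerA Py scaler0.
  by have := r0 _ H; rewrite Ev rho_delta => ->; apply: delta_0.
move=> H; have [n /(_ n (leqnn n)) [v E]] := Tprod_ex charK x.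
apply: (key n) => //; rewrite E.
by have := rho_Tprod n (r0 _ H); rewrite E rho_delta => ->; apply: delta_0.
Qed.

End Rho.

(** * Change of generators *)

Section Psi.
Variables (K : fieldType) (charK : [pchar K] =i pred0) (A : comAlgType K).
Variables (l m : nat) (f : 'I_l -> A) (g : 'I_m -> A) (M : lmodType (diffop A)).
Variables (G : graph_module f M) (H : graph_module g M).
Variables (c : 'I_m -> 'I_l -> A) (cE : forall j, g j = \sum_i c j i * f i).
Local Notation At := (polyext A l).
Local Notation Au := (polyext A m).
Local Notation rhoG := (@rho K charK A l f M G).
Local Notation rhoH := (@rho K charK A m g M H).
Local Notation lc j i := (liftop m (mulop (c j i))).

(** The linear form (c t)_j, which plays the role of u_j on M'. *)
Definition ctp j : At := \sum_i tconst l (c j i) * tvar A i.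
Definition ctw (w : seq 'I_m) : diffop At := mulop (\prod_(j <- w) ctp j).

Lemma ctw_cons j w : ctw (j :: w) = ctw w * mulop (ctp j).
Proof. by rewrite /ctw big_cons mulrC mulopM. Qed.

Lemma mTw_consr (n : nat) (j : 'I_n) w : mTw A (j :: w) = mTw A w * mT A j.
Proof. by rewrite mTw_cons mTw_comm. Qed.

Lemma ctpE j : mulop (ctp j) = \sum_i liftop l (mulop (c j i)) * mT A i.
Proof.
by rewrite mulop_sum; apply: eq_bigr => i _; rewrite mulopM liftop_mulop.
Qed.

(** The graph of Psi. Uniqueness of y is [rho_inj]; existence follows from [gm_ind], the relation
    being compatible with sums, delta and dT. *)
Definition Psi_rel (x : G) (y : H) :=
  forall w, rhoH (mTw A w *: y) = rhoG (ctw w *: x).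

Lemma Psi_rel_uniq x y y' : Psi_rel x y -> Psi_rel x y' -> y = y'.
Proof.
move=> R R'; apply/eqP; rewrite -subr_eq0; apply/eqP/(rho_inj (charK := charK)) => w.
by rewrite scalerBr rhoD rhoN R R' subrr.
Qed.

Lemma Psi_relD x x' y y' : Psi_rel x y -> Psi_rel x' y' -> Psi_rel (x + x') (y + y').
Proof. by move=> R R' w; rewrite !scalerDr !rhoD R R'. Qed.

Lemma Psi_rel_const a x y : Psi_rel x y ->
  Psi_rel (liftop l (mulop a) *: x) (liftop m (mulop a) *: y).
Proof.
move=> R w; rewrite !scalerA -mTw_lift.
rewrite [ctw w * _](_ : _ = liftop l (mulop a) * ctw w).
  by rewrite -!scalerA !rho_lift R.
by rewrite liftop_mulop mulop_comm.
Qed.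

Lemma Psi_rel_ct j x y : Psi_rel x y -> Psi_rel (mulop (ctp j) *: x) (mT A j *: y).
Proof. by move=> R w; rewrite !scalerA -mTw_consr -ctw_cons R. Qed.

(** Each t_i acts on delta(v) through f_i, so the form acts through sum_i c_ji f_i = g_j. *)
Lemma delta_ct j v : mulop (ctp j) *: delta G v = delta G (mulop (g j) *: v).
Proof.
rewrite ctpE scaler_suml cE mulop_sum scaler_suml.
rewrite (big_morph (delta G) (@deltaD _ _ _ _ _ G) (delta_0 G)).
apply: eq_bigr => i _.
by rewrite -scalerA delta_mT liftop_mulop delta_tconst scalerA mulopM.
Qed.

Lemma Psi_rel_delta v : Psi_rel (delta G v) (delta H v).
Proof.
move=> w; elim: w v => [|j w IH] v.
  by rewrite mTw_nil /ctw big_nil mulop1 !scale1r !rho_delta.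
by rewrite mTw_consr ctw_cons -!scalerA delta_mT delta_ct IH.
Qed.

Lemma dT_ct i j : dT A i * mulop (ctp j) =
  mulop (ctp j) * dT A i + liftop l (mulop (c j i)).
Proof.
rewrite ctpE mulr_sumr mulr_suml.
rewrite -[liftop l (mulop (c j i))](sum_eqR (fun i => liftop l (mulop (c j i)))) -big_split.
apply: eq_bigr => i' _; rewrite mulrA -liftop_dT -mulrA dT_mT mulrDr mulrA.
by rewrite eq_sym.
Qed.

(** Chain rule for u = c t. Derivatives have zeroth moment 0; in higher moments, commuting a
    variable past the derivative leaves the same c_ji term on both sides. *)
Lemma Psi_rel_dT i x y : Psi_rel x y ->
  Psi_rel (dT A i *: x) (\sum_j lc j i *: (dT A j *: y)).
Proof.
move=> R w; elim: w x y R => [|j w IH] x y R.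
  rewrite mTw_nil /ctw big_nil mulop1 !scale1r rho_dT.
  rewrite (big_morph rhoH (@rhoD _ _ _ _ _ _ H) (rho0 _ H)) big1 // => j _.
  by rewrite rho_lift rho_dT scaler0.
rewrite mTw_consr ctw_cons -!scalerA.
have -> : mulop (ctp j) *: (dT A i *: x) =
    dT A i *: (mulop (ctp j) *: x) - liftop l (mulop (c j i)) *: x.
  by rewrite !scalerA dT_ct scalerDl addrK.
have -> : mT A j *: (\sum_k lc k i *: (dT A k *: y)) =
    \sum_k lc k i *: (dT A k *: (mT A j *: y)) - lc j i *: y.
  rewrite -[lc j i](sum_eqR (fun k => lc k i)) scaler_suml scaler_sumr -sumrB.
  apply: eq_bigr => k _; rewrite !scalerA -scalerBl; congr (_ *: _).
  by rewrite -!mulrA dT_mT mulrDr eq_sym addrK mulrA mulrA liftop_mT.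
rewrite !scalerBr !rhoD !rhoN (IH _ _ (Psi_rel_ct j R)); congr (_ - _).
exact: (Psi_rel_const (c j i) R).
Qed.

Lemma Psi_ex x : exists y, Psi_rel x y.
Proof.
move: x; apply: (gm_ind charK) => [x x' [y R] [y' R']|v|i x [y R]].
- by exists (y + y'); apply: Psi_relD.
- by exists (delta H v); apply: Psi_rel_delta.
- by eexists; apply: Psi_rel_dT R.
Qed.

Definition Psi x := sval (cid (Psi_ex x)).

Lemma PsiP x : Psi_rel x (Psi x). Proof. by rewrite /Psi; case: cid. Qed.
Lemma PsiE x y : Psi_rel x y -> Psi x = y.
Proof. exact/Psi_rel_uniq/PsiP. Qed.

Lemma PsiD x y : Psi (x + y) = Psi x + Psi y.
Proof. by apply: PsiE; apply: Psi_relD; apply: PsiP. Qed.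
Lemma Psi0 : Psi 0 = 0.
Proof. by apply: (addIr (Psi 0)); rewrite -PsiD !add0r. Qed.
Lemma Psi_const a x : Psi (liftop l (mulop a) *: x) = liftop m (mulop a) *: Psi x.
Proof. by apply: PsiE; apply: Psi_rel_const; apply: PsiP. Qed.
Lemma Psi_ct j x : Psi (mulop (ctp j) *: x) = mT A j *: Psi x.
Proof. by apply: PsiE; apply: Psi_rel_ct; apply: PsiP. Qed.
Lemma Psi_dT i x : Psi (dT A i *: x) = \sum_j lc j i *: (dT A j *: Psi x).
Proof. by apply: PsiE; apply: Psi_rel_dT; apply: PsiP. Qed.
Lemma Psi_delta v : Psi (delta G v) = delta H v.
Proof. by apply: PsiE; apply: Psi_rel_delta. Qed.
Lemma rho_Psi x : rhoH (Psi x) = rhoG x.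
Proof.
by have := PsiP x [::]; rewrite mTw_nil /ctw big_nil mulop1 !scale1r.
Qed.
Lemma Psi_sum (I : Type) (r : seq I) (F : I -> G) :
  Psi (\sum_(i <- r) F i) = \sum_(i <- r) Psi (F i).
Proof. exact: (big_morph Psi PsiD Psi0). Qed.
Lemma PsiN x : Psi (- x) = - Psi x.
Proof. by apply/eqP; rewrite -addr_eq0 -PsiD addNr Psi0. Qed.

Lemma mT_Psi j x : mT A j *: Psi x = \sum_i lc j i *: Psi (mT A i *: x).
Proof.
rewrite -Psi_ct ctpE scaler_suml Psi_sum; apply: eq_bigr => i _.
by rewrite -scalerA Psi_const.
Qed.

(** By [Psi_dT] and [mT_Psi] both sides reduce to sum_(i,j) c_ji dT_j Psi(t_i x). *)
Lemma Psi_euler x : Psi ((\sum_i dT A i * mT A i) *: x) = (\sum_j dT A j * mT A j) *: Psi x.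
Proof.
rewrite scaler_suml Psi_sum.
under eq_bigr do rewrite -scalerA Psi_dT.
rewrite exchange_big scaler_suml; apply: eq_bigr => j _.
rewrite -scalerA mT_Psi scaler_sumr; apply: eq_bigr => i _.
by rewrite !scalerA liftop_dT.
Qed.

(* [exp (ad (sum_ji c_ji dT_j mT_i))], the conjugation relating the actions of
   D_A on the two modules, expanded in iterated commutators *)
Fixpoint exp_ad k (e : diffop A) (y : G) : H :=
  if k is k'.+1 then
    \sum_(p : 'I_m * 'I_l) dT A p.1 *: exp_ad k' (bracket e (c p.1 p.2)) (mT A p.2 *: y)
  else liftop m e *: Psi y.

Lemma exp_ad_eq0 k e y : order_lt k e -> exp_ad k e y = 0.
Proof.
elim: k e y => [|k IH] e y; first by move=> ->; rewrite /= liftop0 scale0r.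
move=> ek /=; rewrite big1 // => p _.
by rewrite IH ?scaler0 //; apply: order_lt_bracket.
Qed.

(** The second sum comes from moving c_ji past the innermost operator, the third from moving t_j
    past the k derivatives. After division by k! they are consecutive terms of one sequence and will
    telescope. At k = 0 the truncated [k.-1] does no harm, its sum being taken 0 times. *)
Lemma mT_exp_ad k e y j : mT A j *: exp_ad k e y =
  \sum_i lc j i *: exp_ad k e (mT A i *: y) + \sum_i exp_ad k (bracket e (c j i)) (mT A i *: y)
   - (\sum_i exp_ad k.-1 (bracket e (c j i)) (mT A i *: y)) *+ k.
Proof.
elim: k e y => [|k IH] e y.
  rewrite mulr0n subr0 /= scalerA -liftop_mT -scalerA mT_Psi scaler_sumr -big_split.
  apply: eq_bigr => i _ /=; rewrite !scalerA -scalerDl -!liftopM -liftopD; congr (_ *: _).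
  by rewrite /bracket addrC subrK.
pose Y (p : 'I_m * 'I_l) i : G := mT A p.2 *: (mT A i *: y).
have E (p : 'I_m * 'I_l) : mT A j *: (dT A p.1 *: exp_ad k (bracket e (c p.1 p.2)) (mT A p.2 *: y)) =
    \sum_i lc j i *: (dT A p.1 *: exp_ad k (bracket e (c p.1 p.2)) (Y p i))
  + \sum_i dT A p.1 *: exp_ad k (bracket (bracket e (c j i)) (c p.1 p.2)) (Y p i)
  - (\sum_i dT A p.1 *: exp_ad k.-1 (bracket (bracket e (c j i)) (c p.1 p.2)) (Y p i)) *+ k
  - (j == p.1)%:R *: exp_ad k (bracket e (c p.1 p.2)) (mT A p.2 *: y).
  set z := exp_ad k (bracket e (c p.1 p.2)) (mT A p.2 *: y).
  have -> : mT A j *: (dT A p.1 *: z) = dT A p.1 *: (mT A j *: z) - (j == p.1)%:R *: z.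
    by rewrite !scalerA dT_mT scalerDl eq_sym addrK.
  have YE i : mT A i *: (mT A p.2 *: y) = Y p i by rewrite /Y !scalerA mT_comm.
  congr (_ - _); rewrite /z IH scalerBr scalerDr -scalerMnr !scaler_sumr.
  congr (_ + _ - _ *+ _); apply: eq_bigr => i _; rewrite YE ?[bracket (bracket e (c j i)) _]bracketC //.
  by rewrite !scalerA liftop_dT.
rewrite [exp_ad k.+1]/= scaler_sumr; under eq_bigr do rewrite E.
rewrite !sumrB big_split /= mulrSr opprD addrA.
have X3 : (\sum_i exp_ad k (bracket e (c j i)) (mT A i *: y)) *+ k =
  (\sum_(p : 'I_m * 'I_l) \sum_i dT A p.1 *: exp_ad k.-1 (bracket (bracket e (c j i)) (c p.1 p.2)) (Y p i)) *+ k.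
  case: (k) => [|k'] //=; congr (_ *+ _); rewrite exchange_big; apply: eq_bigr => i _.
  by [].
have X4 : \sum_(p : 'I_m * 'I_l) (j == p.1)%:R *: exp_ad k (bracket e (c p.1 p.2)) (mT A p.2 *: y)
   = \sum_i exp_ad k (bracket e (c j i)) (mT A i *: y).
  rewrite -(pair_bigA _ (fun j' i => (j == j')%:R *: exp_ad k (bracket e (c j' i)) (mT A i *: y))) /=.
  rewrite (bigD1 j) //= [X in _ + X]big1 ?addr0; first by apply: eq_bigr => i _; rewrite eqxx scale1r.
  by move=> j' /negbTE nj; rewrite big1 // => i _; rewrite eq_sym nj scale0r.
rewrite X4 sumrMnl -X3; congr (_ + _ - _ - _).
  rewrite exchange_big; apply: eq_bigr => i _; rewrite scaler_sumr.
  by apply: eq_bigr.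
by rewrite exchange_big.
Qed.

Definition invfact k : diffop Au := mulop (((k`!)%:R^-1 : K)%:A).

Lemma invfact_comm k d : invfact k * d = d * invfact k.
Proof. exact: mulop_scalar_comm. Qed.

Lemma invfactS k (z : H) : invfact k.+1 *: (z *+ k.+1) = invfact k *: z.
Proof.
rewrite -scaler_nat scalerA -mulop_nat /invfact -mulopM -(scaler_nat k.+1 1) -scalerAr mulr1.
rewrite scalerA factS natrM invfM mulrA mulfV ?mul1r //; exact: nat_neq0.
Qed.

(** The difference D of the two sides satisfies t_j D(z) = sum_i c_ji D(t_i z), and rho(D z) = 0
    since the terms of positive index are derivatives. Hence all moments of D vanish and [rho_inj]
    applies. *)
Lemma Psi_lift k e y : order_le k e ->
  Psi (liftop l e *: y) = \sum_(i < k.+1) invfact i *: exp_ad i e y.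
Proof.
move=> ek; pose D y := \sum_(i < k.+1) invfact i *: exp_ad i e y - Psi (liftop l e *: y).
suff D0 : D y = 0 by apply/eqP; rewrite eq_sym -subr_eq0; apply/eqP.
have DT j z : mT A j *: D z = \sum_i lc j i *: D (mT A i *: z).
  under eq_bigr do rewrite scalerBr.
  rewrite sumrB /D scalerBr; congr (_ - _); last first.
    rewrite mT_Psi; apply: eq_bigr => i _.
    by rewrite [in LHS]scalerA [in RHS]scalerA liftop_mT.
  under [RHS]eq_bigr do rewrite scaler_sumr.
  rewrite [RHS]exchange_big [LHS]scaler_sumr.
  (* Terms of the telescoping sum: the first is set to 0, and the last vanishes because e has order
     at most k, so that k + 1 successive brackets of it are zero. *)
  pose B n : H := if n is n'.+1 then invfact n' *: \sum_i exp_ad n' (bracket e (c j i)) (mT A i *: z) else 0.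
  have E n : mT A j *: (invfact n *: exp_ad n e z) =
      \sum_i lc j i *: (invfact n *: exp_ad n e (mT A i *: z)) + (B n.+1 - B n).
    rewrite scalerA -invfact_comm -scalerA mT_exp_ad scalerBr scalerDr -addrA; congr (_ + _).
      rewrite scaler_sumr; apply: eq_bigr => i _.
      by rewrite [in LHS]scalerA [in RHS]scalerA invfact_comm.
    congr (_ - _); case: n => [|n]; first by rewrite mulr0n scaler0.
    exact: invfactS.
  under [LHS]eq_bigr do rewrite E.
  rewrite big_split /= -[RHS]addr0; congr (_ + _).
  rewrite -(big_mkord xpredT (fun n => B n.+1 - B n)) telescope_sumr // subr0 /=.
  rewrite big1 ?scaler0 // => i _; apply: exp_ad_eq0.
  by apply: order_lt_bracket.
have D_rho z : rhoH (D z) = 0.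
  rewrite /D rhoD rhoN rho_Psi rho_lift -(rho_Psi z) big_ord_recl rhoD.
  rewrite /invfact /= fact0 invr1 scale1r mulop1 scale1r rho_lift.
  rewrite [rhoH (\sum_(i < k) _)](_ : _ = 0) ?addr0 ?subrr //.
  rewrite (big_morph rhoH (@rhoD _ _ _ _ _ _ H) (rho0 _ H)) big1 // => i _.
  apply: rho_T; apply: in_T_op; first by move=> j; exact: mulop_scalar_comm.
  apply: (big_ind (@in_T K A m g M H)) => [||p _]; [exact: in_T0|exact: in_TD|].
  exact: in_T_dT.
apply: (rho_inj (charK := charK)) => w; elim: w y => [|j w IH] y.
  by rewrite mTw_nil scale1r.
rewrite mTw_consr -scalerA DT scaler_sumr.
rewrite (big_morph rhoH (@rhoD _ _ _ _ _ _ H) (rho0 _ H)) big1 // => i _.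
by rewrite scalerA -mTw_lift -scalerA rho_lift IH scaler0.
Qed.

End Psi.

(** * Operators of A[t] and the V-filtration *)

Section Low.
Variables (K : fieldType) (A : comAlgType K) (l : nat).
Local Notation At := (polyext A l).
Implicit Types (p q : At) (r : int).

(** Membership in <t>^r read off the coefficients (see [ideal_powerP]); for r <= 0 nothing is
    imposed. *)
Definition tadic r p := forall b, ((mdeg b)%:Z < r) -> mcoeff b p = 0.

Lemma tadic0 r : tadic r (0 : At). Proof. by move=> b _; rewrite mcoeff0. Qed.
Lemma tadicD r p q : tadic r p -> tadic r q -> tadic r (p + q).
Proof. by move=> Hp Hq b br; rewrite mcoeffD Hp // Hq // addr0. Qed.
Lemma tadicN r p : tadic r p -> tadic r (- p).
Proof. by move=> Hp b br; rewrite mcoeffN Hp // oppr0. Qed.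

Lemma tadic_tmono r b a : r <= (mdeg b)%:Z -> tadic r (tmono A b * tconst l a).
Proof.
move=> rb c cr; rewrite mulrC mcoeffCM mcoeffX; case: eqP => [bc|_]; last exact: mulr0.
by move: cr; rewrite -bc ltNge rb.
Qed.

Lemma tadic_tmonoM b p : tadic (mdeg b)%:Z (tmono A b * p).
Proof.
elim/polyext_ind: p => [|p q Hp Hq|c a]; first by rewrite mulr0; apply: tadic0.
  by rewrite mulrDr; apply: tadicD.
rewrite mulrA -[tmono A b * tmono A c](mpolyXD A); apply: tadic_tmono.
by rewrite mdegD lez_nat leq_addr.
Qed.

Lemma prod_tvar k (s : 'I_k -> 'I_l) :
  exists2 b, mdeg b = k & \prod_u tvar A (s u) = tmono A b.
Proof.
elim: k s => [|k IH] s; first by exists mnm0; rewrite ?mdeg0 // big_ord0 tmono0.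
rewrite big_ord_recl; have [b bk ->] := IH (fun u => s (fintype.lift ord0 u)).
by exists (mnm_add (mnm1 (s ord0)) b); rewrite ?mdegD ?mdeg1 ?bk // tmonoS.
Qed.

Lemma tmono_prod k b : (k <= mdeg b)%N ->
  exists (s : 'I_k -> 'I_l) b', tmono A b = tmono A b' * \prod_u tvar A (s u).
Proof.
elim: k b => [|k IH] b kb.
  have s0 (u : 'I_0) : 'I_l by case: u.
  by exists s0, b; rewrite big_ord0 mulr1.
move: b kb; apply: (@mnm_ind l) => [|i b _]; first by rewrite mdeg0.
rewrite mdegD mdeg1 => /IH [s [b' E]].
exists (fun u => if unlift ord0 u is Some v then s v else i), b'.
rewrite tmonoS E big_ord_recl unlift_none mulrCA; congr (_ * (_ * _)).
by apply: eq_bigr => u _; rewrite liftK.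
Qed.

Lemma ideal_powerP r p : ideal_power (@tvar K A l) r p <-> tadic r p.
Proof.
case: r => k /=; last by split=> // _ b; rewrite ltNge.
split=> [[c ->]|H].
  apply: (big_ind (tadic k)) => [||s _]; [exact: tadic0|exact: tadicD|].
  have [b bk ->] := prod_tvar s; rewrite mulrC -bk; exact: tadic_tmonoM.
rewrite (polyext_expand p) big_seq.
apply: (big_ind [set b | exists c : {ffun 'I_k -> 'I_l} -> At,
                b = \sum_s c s * \prod_(u < k) tvar A (s u)]) => /=.
- by exists (fun=> 0); rewrite big1 // => s _; rewrite mul0r.
- move=> _ _ [c ->] [c' ->]; exists (fun s => c s + c' s).
  by rewrite -big_split; apply: eq_bigr => s _; rewrite mulrDl.
- move=> b; rewrite mcoeff_msupp => pb.
  have kb : (k <= mdeg b)%N.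
    by rewrite leqNgt; apply/negP => bk; rewrite H ?eqxx // in pb.
  have [s [b' ->]] := tmono_prod kb.
  exists (fun s' => if s' == finfun s then tmono A b' * tconst l (mcoeff b p) else 0).
  rewrite (bigD1 (finfun s)) //= eqxx [X in _ + X]big1 ?addr0; last first.
    by move=> s' /negbTE ->; rewrite mul0r.
  by rewrite mulrAC; congr (_ * _ * _); apply: eq_bigr => u _; rewrite ffunE.
Qed.

Definition degV r (d : diffop At) := forall j p, tadic j p -> tadic (j + r) (d p).

Lemma V_diffopP r d : V_diffop r d <-> degV r d.
Proof.
by split=> H j p /ideal_powerP /H /ideal_powerP.
Qed.

Lemma degV_add r d e : degV r d -> degV r e -> degV r (d + e).
Proof. by move=> Hd He j p Hp; apply: tadicD; [apply: Hd|apply: He]. Qed.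
Lemma degV_opp r d : degV r d -> degV r (- d).
Proof. by move=> Hd j p Hp; apply: tadicN; apply: Hd. Qed.
Lemma degV_mul r r' d e : degV r d -> degV r' e -> degV (r + r') (d * e).
Proof. by move=> Hd He j p /He /Hd; rewrite -addrA [r' + r]addrC. Qed.
Lemma degV_lift e : degV 0 (liftop l e).
Proof. by move=> j p Hp b; rewrite addr0 coef_lift => /Hp ->; apply: diffop0. Qed.

Lemma tadic_ind r (P : At -> Prop) : P 0 -> (forall p q, P p -> P q -> P (p + q)) ->
  (forall b a, r <= (mdeg b)%:Z -> P (tmono A b * tconst l a)) ->
  forall p, tadic r p -> P p.
Proof.
move=> P0 PD PM p Hp; rewrite (polyext_expand p) big_seq; apply: (big_ind P) => // b.
rewrite mcoeff_msupp => pb; apply: PM; rewrite leNgt; apply/negP => /Hp E.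
by rewrite E eqxx in pb.
Qed.

Lemma degV_mT i : degV 1 (mT A i).
Proof.
move=> j; apply: tadic_ind => [|p q Hp Hq|b a jb].
- by rewrite diffop0; apply: tadic0.
- by rewrite diffop_add; apply: tadicD.
- rewrite /= mulrA -tmonoS; apply: tadic_tmono.
  by rewrite mdegD mdeg1 PoszD addrC lerD2l.
Qed.

Lemma degV_dT i : degV (-1) (dT A i).
Proof.
move=> j p Hp b bj; rewrite mcoeff_mderiv Hp ?mul0rn //.
by rewrite mdegD mdeg1 PoszD -ltrBrDr.
Qed.

End Low.

(** * Generators of the V-filtered ring of operators on A[t] *)

Section Structure.
Variables (K : fieldType) (charK : [pchar K] =i pred0) (A : comAlgType K) (l : nat).
Local Notation At := (polyext A l).
Hypothesis finite_test : forall k, exists s : seq A, forall e : diffop A,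
  order_le k e -> (forall a, a \in s -> e a = 0) -> e = 0.
(** Any decreasing multiplicative filtration in which D_A, t_i and dT_i have degrees 0, 1 and -1. It
    will be specialized to the operators that shift [Vgraph] by r. *)
Variable L : int -> diffop At -> Prop.
Hypothesis L0 : forall r, L r 0.
Hypothesis LD : forall r d e, L r d -> L r e -> L r (d + e).
Hypothesis LM : forall r r' d e, L r d -> L r' e -> L (r + r') (d * e).
Hypothesis L_le : forall r r' d, r' <= r -> L r d -> L r' d.
Hypothesis L_mT : forall i, L 1 (mT A i).
Hypothesis L_dT : forall i, L (-1) (dT A i).
Hypothesis L_lift : forall e, L 0 (liftop l e).

Lemma L_tmono b : L (mdeg b)%:Z (mulop (tmono A b)).
Proof.
elim/mnm_ind: b => [|i b IH]; last first.
  by rewrite tmonoS mulopM mdegD mdeg1 PoszD; exact: (LM (L_mT i) IH).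
rewrite mdeg0 tmono0 [mulop 1](_ : _ = liftop l 1); first exact: L_lift.
by rewrite -mulop1 liftop_mulop tconst1.
Qed.

Definition coef_fun b (d : At -> At) (a : A) := mcoeff b (d (tconst l a)).

Lemma coef_fun_klin b d : klin d -> klin (coef_fun b d).
Proof.
move=> dl c x y; rewrite /coef_fun -scaleE -mcoeffD -dl; congr (mcoeff b (d _)).
by apply: polyext_ext => b'; rewrite mcoeffD scaleE !mcoeffC mulrDl scalerAl.
Qed.

Lemma tconstM a a' : tconst l (a * a') = tconst l a * tconst l a' :> At.
Proof. exact: (@mpolyCM l A). Qed.

Lemma coef_fun_order k b d : diff_order k d -> diff_order k (coef_fun b d).
Proof.
elim: k d => [|k IH] d dk a.
  by move=> x; rewrite /coef_fun tconstM dk mcoeffCM.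
apply: diff_order_ext (IH _ (dk (tconst l a))) => x.
by rewrite /coef_fun tconstM mcoeffB mcoeffCM.
Qed.

Lemma is_diffop_coef b (d : diffop At) : is_diffop (coef_fun b d).
Proof.
split; first by apply: coef_fun_klin; case: (diffopP d).
by have [k dk] := orderP d; exists k; apply: coef_fun_order.
Qed.

Definition coef_op b d : diffop A := Diffop (is_diffop_coef b d).

Lemma comm_tmono (d : diffop At) b : (forall i, d * mT A i = mT A i * d) ->
  d * mulop (tmono A b) = mulop (tmono A b) * d.
Proof.
move=> C; elim/mnm_ind: b => [|i b IH]; first by rewrite tmono0 mulop1 mulr1 mul1r.
by rewrite tmonoS mulopM mulrA C -mulrA IH mulrA.
Qed.

(** Commuting with t, the operator is determined by its restriction to A, to be expanded as sum_b
    t^b e_b. Each e_b has order at most k, hence is zero once it kills the test set s; so only the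
    finitely many monomials in the images of s occur. Those with |b| < r drop out by the degree
    condition. *)
Lemma flat_generated k r d : order_le k d -> degV r d ->
  (forall i, d * mT A i = mT A i * d) -> L r d.
Proof.
move=> dk dr C; have [s sP] := finite_test k.
pose S := undup (flatten [seq msupp (d (tconst l a)) | a <- s]).
have e0 b : b \notin S -> coef_op b d = 0.
  move=> bS; apply: sP; first exact: coef_fun_order.
  move=> a sa; apply: memN_msupp_eq0; apply: contra bS => bd.
  by rewrite mem_undup; apply/flatten_mapP; exists a.
have r0 b : (mdeg b)%:Z < r -> coef_op b d = 0.
  move=> br; apply: diffop_ext => a; rewrite diffopE0.
  apply: (dr 0 (tconst l a)) => [c|]; first by rewrite ltNge.
  by rewrite add0r.
have -> : d = \sum_(b <- S) mulop (tmono A b) * liftop l (coef_op b d).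
  apply: diffop_ext => p; rewrite diffop_sumE.
  elim/polyext_ind: p => [|p q Hp Hq|c a].
  - by rewrite diffop0 big1 // => b _; rewrite diffop0.
  - rewrite diffop_add Hp Hq -big_split; apply: eq_bigr => b _.
    by rewrite [RHS]diffop_add.
  - have -> : d (tmono A c * tconst l a) = tmono A c * d (tconst l a).
      by have /(congr1 (fun e : diffop At => e (tconst l a))) := comm_tmono c C.
    have -> : d (tconst l a) = \sum_(b <- S) tmono A b * tconst l (coef_op b d a).
      apply: polyext_ext => b; rewrite raddf_sum /=.
      under eq_bigr do rewrite mulrC mcoeffCM mcoeffX.
      rewrite sum_delta ?undup_uniq //; case: ifPn => // /e0 E.
      exact: (congr1 (fun e : diffop A => e a) E).
    rewrite mulr_sumr; apply: eq_bigr => b _.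
    by rewrite diffopEmul [liftop _ _ _]lift_fun_mono mulopE mulrCA.
apply: big_ind => [||b _]; [exact: L0|exact: LD|].
case: (ltP (mdeg b)%:Z r) => [/r0 ->|rb]; first by rewrite liftop0 mulr0; apply: L0.
apply: (L_le rb); rewrite -[X in L X _]addr0; apply: LM; [exact: L_tmono|exact: L_lift].
Qed.

Definition ad_mT (i : 'I_l) n (d : diffop At) :=
  iter n (fun e : diffop At => bracket e (tvar A i)) d.

Lemma ad_mT_order i n k d : order_le k d -> order_le (k - n) (ad_mT i n d).
Proof.
move=> dk; elim: n => [|n IH]; first by rewrite subn0.
by rewrite subnS; apply: order_comm_pred.
Qed.

Lemma ad_mT_deg i n r d : degV r d -> degV (r + n%:Z) (ad_mT i n d).
Proof.
move=> dr; elim: n => [|n IH]; first by rewrite addr0.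
have -> : r + n.+1%:Z = r + n%:Z + 1 by rewrite -addn1 PoszD addrA.
rewrite [ad_mT _ _ _]iterS; apply: degV_add; first exact: (degV_mul IH (degV_mT _)).
by apply: degV_opp; rewrite addrC; exact: (degV_mul (degV_mT _) IH).
Qed.

Lemma ad_mT_last i k d : order_le k d -> ad_mT i k.+1 d = 0.
Proof.
move=> dk; have := ad_mT_order i k dk; rewrite subnn => H.
by rewrite /ad_mT iterS /bracket (order0_comm _ H) subrr.
Qed.

Definition tcoef n : diffop At := mulop (((-1) ^+ n / n`!%:R : K)%:A).

Lemma tcoef_comm n d : tcoef n * d = d * tcoef n. Proof. exact: mulop_scalar_comm. Qed.

Lemma tcoef0 : tcoef 0 = 1.
Proof. by rewrite /tcoef expr0 fact0 invr1 mulr1 scale1r. Qed.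

Lemma tcoefS n : tcoef n.+1 *+ n.+1 = - tcoef n.
Proof.
rewrite -mulr_natr -mulop_nat /tcoef -mulopM -(scaler_nat n.+1 1) -scalerAr mulr1 scalerA.
rewrite -mulopN -scaleNr; congr (mulop (_ *: _)).
rewrite factS natrM invfM mulrCA mulrA mulrA mulfK ?nat_neq0 //.
by rewrite exprS mulN1r mulNr.
Qed.

Lemma dTn_mT (i j : 'I_l) n : dT A i ^+ n * mT A j =
  mT A j * dT A i ^+ n + (i == j)%:R * dT A i ^+ n.-1 *+ n.
Proof.
elim: n => [|n IH]; first by rewrite mulr0n addr0 expr0 mulr1 mul1r.
rewrite exprS -mulrA IH mulrDr mulrA dT_mT mulrDl -!mulrA -addrA; congr (_ + _).
rewrite mulrnAr mulrA natr_comm -mulrA mulrS; congr (_ + _).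
by case: n {IH} => [|n]; rewrite ?mulr0n // exprS.
Qed.

(* The part of [d] that commutes with [t_i] (a Taylor expansion at [dT_i = 0]);
   [d - flat i k d] involves only the commutators of [d], of lower order. *)
Definition flat i k d := \sum_(n < k.+1) tcoef n * ad_mT i n d * dT A i ^+ n.

Lemma dTn_deg (i : 'I_l) n : degV (- n%:Z) (dT A i ^+ n).
Proof.
elim: n => [|n IH].
  by rewrite expr0 -mulop1 -(@tconst1 K A l) -liftop_mulop oppr0; apply: degV_lift.
by rewrite exprS -addn1 PoszD opprD addrC; apply: degV_mul => //; apply: degV_dT.
Qed.

Lemma dTn_order (i : 'I_l) n : order_le n (dT A i ^+ n).
Proof.
elim: n => [|n IH]; first exact: order_mulop.
rewrite exprS -add1n; apply: order_mul => //.
move=> b c x /=; rewrite !(mderivM i (_ : mpoly l A)).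
by ring.
Qed.

Lemma flat_order i k d : order_le k d -> order_le k (flat i k d).
Proof.
move=> dk; apply: order_sum => n _.
have := ltn_ord n; move: (nat_of_ord n) => {}n; rewrite ltnS => nk.
apply: (@order_leq _ _ (0 + (k - n) + n)); first by rewrite add0n subnK.
apply: order_mul; last exact: dTn_order.
by apply: order_mul; [exact: order_mulop|exact: ad_mT_order].
Qed.

Lemma flat_deg i k r d : degV r d -> degV r (flat i k d).
Proof.
move=> dr; apply: big_ind => [||n _].
- by move=> j p _; rewrite diffopE0; apply: tadic0.
- by move=> *; apply: degV_add.
- have -> : r = 0 + (r + n%:Z) + (- n%:Z) by rewrite add0r addrK.
  apply: degV_mul; last exact: dTn_deg.
  apply: degV_mul; last exact: ad_mT_deg.
  rewrite /tcoef scalarE -liftop_mulop; exact: degV_lift.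
Qed.

(** The commutator of the n-th summand with t_i is B(n) - B(n+1). The sum telescopes to 0: B(0) has
    coefficient 0, and B(k+1) contains a (k+1)-fold bracket of an operator of order at most k. *)
Lemma flat_comm i k d : order_le k d -> flat i k d * mT A i = mT A i * flat i k d.
Proof.
move=> dk; apply/eqP; rewrite -subr_eq0 mulr_suml mulr_sumr -sumrB; apply/eqP.
pose B n := (tcoef n *+ n) * ad_mT i n d * dT A i ^+ n.-1.
have E n : tcoef n * ad_mT i n d * dT A i ^+ n * mT A i
    - mT A i * (tcoef n * ad_mT i n d * dT A i ^+ n) = - (B n.+1 - B n).
  have -> : B n.+1 = - (tcoef n * ad_mT i n d * mT A i * dT A i ^+ n)
      + mT A i * (tcoef n * ad_mT i n d * dT A i ^+ n).
    rewrite /B tcoefS [ad_mT i n.+1 d]iterS -/(ad_mT i n d) {1}/bracket /=.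
    rewrite !mulNr mulrBr mulrBl opprB addrC !mulrA; congr (_ + _).
    by rewrite -[mT A i * tcoef n]tcoef_comm.
  have -> : tcoef n * ad_mT i n d * dT A i ^+ n * mT A i =
      tcoef n * ad_mT i n d * mT A i * dT A i ^+ n + B n.
    rewrite -[LHS]mulrA dTn_mT eqxx mul1r mulrDr mulrA; congr (_ + _).
    by rewrite /B mulrnAr -!mulrnAl.
  by rewrite opprB opprD opprK addrCA addrA.
under eq_bigr do rewrite E.
rewrite sumrN -(big_mkord xpredT (fun n => B n.+1 - B n)) telescope_sumr //.
by rewrite /B ad_mT_last // mulr0 mul0r mulr0n !mul0r subrr oppr0.
Qed.

(** Allows the variables to be treated one after the other, commutation already achieved being
    kept. *)
Lemma flat_comm_other i j k d : i != j -> d * mT A j = mT A j * d ->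
  flat i k d * mT A j = mT A j * flat i k d.
Proof.
move=> ij C.
rewrite mulr_suml mulr_sumr; apply: eq_bigr => n _.
have -> : tcoef n * ad_mT i n d * dT A i ^+ n * mT A j = tcoef n * (ad_mT i n d * mT A j) * dT A i ^+ n.
  by rewrite -!mulrA dTn_mT (negbTE ij) mul0r mul0rn addr0.
suff -> : ad_mT i n d * mT A j = mT A j * ad_mT i n d by rewrite !mulrA tcoef_comm.
elim: (nat_of_ord n) => [|n' IH] //.
rewrite [ad_mT _ _ _]iterS /bracket mulrBl mulrBr -!mulrA [mT A i * mT A j]mT_comm IH.
by rewrite !mulrA IH [mT A i * mT A j]mT_comm.
Qed.

Lemma flatE i k d : d = flat i k d - \sum_(n < k) tcoef n.+1 * ad_mT i n.+1 d * dT A i ^+ n.+1.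
Proof.
by rewrite /flat big_ord_recl tcoef0 mul1r expr0 mulr1 addrK.
Qed.

(** Induction on the order, and inside it on a list s of the variables with which d may fail to
    commute. [flat] removes one variable from s at the same order; the correction terms of [flatE]
    involve iterated brackets of lower order. The empty list is [flat_generated]. *)
Lemma degV_generated r d : degV r d -> L r d.
Proof.
have [k] := orderP d; have [k'] := ubnP k; elim: k' k r d => // k' IHk k r d kk' dk dr.
suff : forall s : seq 'I_l, (forall i, i \notin s -> d * mT A i = mT A i * d) -> L r d.
  by move/(_ (enum 'I_l)); apply => i; rewrite mem_enum.
move=> s; elim: s d dk dr => [|i s IHs] d dk dr C.
  by apply: flat_generated dk dr _ => i; apply: C.
have Lneg e r' : L r' e -> L r' (- e).
  move=> He; have -> : - e = liftop l (mulop (-1)) * e.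
    by rewrite liftop_mulop tconstN tconst1 mulopN mulop1 mulN1r.
  by rewrite -[r']add0r; apply: LM.
rewrite (flatE i k d); apply: LD.
  apply: IHs; [exact: flat_order|exact: flat_deg|].
  move=> j js; case: (eqVneq j i) => [->|ji]; first exact: flat_comm.
  by apply: flat_comm_other; rewrite 1?eq_sym //; apply: C; rewrite inE negb_or ji.
apply: Lneg; apply: big_ind => [||n _]; [exact: L0|exact: LD|].
have -> : r = 0 + (r + n.+1%:Z) + (- n.+1%:Z) by rewrite add0r addrK.
apply: LM; last first.
  elim: n.+1 => [|n' IH]; last first.
    by rewrite exprS -addn1 PoszD opprD addrC; apply: LM.
  by rewrite expr0 -mulop1 -(@tconst1 K A l) -liftop_mulop oppr0.
apply: LM; first by rewrite /tcoef scalarE -liftop_mulop.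
have ltk : (k - n.+1 < k)%N by rewrite ltn_subrL /=; case: (k) n => [[]|].
apply: (IHk (k - n.+1)%N).
- by apply: leq_trans ltk _; rewrite -ltnS.
- exact: ad_mT_order.
- exact: ad_mT_deg.
Qed.

End Structure.

(** * Finite determination of differential operators *)

Section Algebraic.
Variables (K : fieldType) (charK : [pchar K] =i pred0) (A : comAlgType K).

Definition evA r (T : 'I_r -> A) (q : mpoly r K) : A := mmap (in_alg A) T q.

Lemma evAE r (T : 'I_r -> A) q :
  evA T q = \sum_(b <- msupp q) mcoeff b q *: \prod_i T i ^+ b i.
Proof. by apply: eq_bigr => b _; rewrite /mmap1 /= mulr_algl. Qed.

Lemma evAZ r (T : 'I_r -> A) c b : evA T (c *: mpolyX K b) = c *: \prod_i T i ^+ b i.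
Proof. by rewrite /evA mmapZ mmapX /mmap1 /= mulr_algl. Qed.
Lemma evAC r (T : 'I_r -> A) c : evA T (mpolyC r c) = c%:A.
Proof. exact: mmapC. Qed.

Definition indep r (T : 'I_r -> A) := forall q, evA T q = 0 -> q = 0.

Definition extend r (T : 'I_r -> A) (b : A) (i : 'I_r.+1) : A :=
  oapp T b (insub (nat_of_ord i)).

Lemma extend_widen r (T : 'I_r -> A) b i : extend T b (widen_ord (leqnSn r) i) = T i.
Proof. by rewrite /extend /= (valK i). Qed.
Lemma extend_max r (T : 'I_r -> A) b : extend T b ord_max = b.
Proof. by rewrite /extend /= insubF // ltnn. Qed.

Definition restr r (b : multinom r.+1) : multinom r :=
  Multinom [tuple b (widen_ord (leqnSn r) i) | i < r].

Lemma muni_coef r (q : mpoly r.+1 K) b :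
  mcoeff (restr b) (muni q)`_(b ord_max) = mcoeff b q.
Proof.
rewrite muniE coef_sum raddf_sum /=.
have E b' : mcoeff (restr b) ((mcoeff b' q *: mpolyX K (restr b')) *: 'X^(b' ord_max) : {poly mpoly r K})`_(b ord_max)
    = mcoeff b' q * (b' == b)%:R.
  rewrite coefZ coefXn; case: (eqVneq b' b) => [->|nb].
    by rewrite eqxx !mulr1 mcoeffZ mcoeffX eqxx mulr1.
  case: eqP => [E1|_]; last by rewrite !mulr0 mcoeff0.
  rewrite mulr1 mcoeffZ mcoeffX; case: eqP => [E2|//]; exfalso; move/eqP: nb; apply.
  apply/mnmP => i; case: (unliftP ord_max i) => [j|] ->; last by rewrite E1.
  have := congr1 (fun c : multinom r => c j) E2; rewrite !mnmE => E3.
  have -> : fintype.lift ord_max j = widen_ord (leqnSn r) j by apply: val_inj; exact: lift_max.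
  exact: E3.
under eq_bigr do rewrite E.
rewrite sum_delta ?msupp_uniq //; case: ifPn => // bq.
by rewrite (memN_msupp_eq0 bq).
Qed.

Lemma muni_neq0 r (q : mpoly r.+1 K) : q != 0 -> muni q != 0.
Proof.
apply: contra => /eqP E; apply/eqP/mpolyP => b.
by rewrite -muni_coef E coef0 !mcoeff0.
Qed.

Lemma muni_horner r (T : 'I_r -> A) b q :
  (map_poly (evA T) (muni q)).[b] = evA (extend T b) q.
Proof.
pose ev : {rmorphism mpoly r K -> A} := mmap (in_alg A) T.
rewrite muniE -[map_poly _]/(map_poly ev) raddf_sum /= horner_sum evAE.
apply: eq_bigr => c _; rewrite linearZ_LR /= map_polyXn hornerZ hornerXn.
rewrite -/(restr c) [mmap _ _ _]evAZ -scalerAl; congr (_ *: _).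
rewrite big_ord_recr /= extend_max; congr (_ * _); apply: eq_bigr => i _.
by rewrite extend_widen mnmE.
Qed.

Lemma mulrn_neq0 (r : nat) (q : mpoly r K) k : q != 0 -> q *+ k.+1 != 0.
Proof.
move=> q0; rewrite -mulr_natl mulf_neq0 // -(@mpolyC_nat r K) mpolyC_eq0.
exact: nat_neq0.
Qed.

(** Start from any nonzero relation Q(b) = 0. It is not constant, T being independent, so in
    characteristic zero Q' is nonzero of smaller degree; as long as Q'(b) = 0, replace Q by Q'. *)
Lemma minimal_relation r (T : 'I_r -> A) b : indep T -> ~ indep (extend T b) ->
  exists Q : {poly mpoly r K}, (map_poly (evA T) Q).[b] = 0 /\
    (map_poly (evA T) Q)^`().[b] != 0.
Proof.
move=> iT nT; pose ev : {rmorphism mpoly r K -> A} := mmap (in_alg A) T.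
have ex : exists Q : {poly mpoly r K}, Q != 0 /\ (map_poly ev Q).[b] = 0.
  apply: contrapT => H; apply: nT => q Eq; apply/eqP; case: (eqVneq q 0) => // q0; exfalso.
  by apply: H; exists (muni q); split; [exact: muni_neq0|rewrite [LHS]muni_horner].
have [Q [Q0 QE]] := ex.
have [k] := ubnP (size Q); elim: k Q Q0 QE => // k IH Q Q0 QE sQ.
rewrite ltnS in sQ.
have s1 : (1 < size Q)%N.
  rewrite ltnNge; apply/negP => /size1_polyC E.
  move: QE; rewrite E map_polyC hornerC => /iT E0.
  by move: Q0; rewrite E E0 eqxx.
have Q'0 : Q^`() != 0.
  case ES: (size Q) s1 => [|[|n]] // _.
  apply/eqP => /(congr1 (fun P : {poly mpoly r K} => P`_n)) /eqP.
  rewrite coef_deriv coef0; apply/negP/mulrn_neq0.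
  by move: Q0; rewrite -lead_coef_eq0 lead_coefE ES.
case: (eqVneq (map_poly ev Q)^`().[b] 0) => [E|nE]; last by exists Q.
apply: (IH Q^`()) => //; first by rewrite -deriv_map.
exact: leq_trans (lt_size_deriv Q0) sQ.
Qed.

Lemma evA_mulop r (T : 'I_r -> A) (e : diffop A) q :
  (forall i, e * mulop (T i) = mulop (T i) * e) ->
  e * mulop (evA T q) = mulop (evA T q) * e.
Proof.
move=> C; rewrite evAE mulop_sum mulr_sumr mulr_suml; apply: eq_bigr => b _.
rewrite -mulr_algl mulopM mulrA -mulop_scalar_comm -!mulrA; congr (_ * _).
apply: (big_ind (fun x => e * mulop x = mulop x * e)) => [|x y Hx Hy|i _].
- by rewrite mulop1 mulr1 mul1r.
- by rewrite mulopM mulrA Hx -!mulrA Hy.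
- by elim: (b i) => [|k IH]; rewrite ?mulop1 ?mulr1 ?mul1r // exprS mulopM mulrA C -!mulrA IH.
Qed.

(** The Leibniz rule [e, Q(b)] = Q'(b) [e, b], valid since e commutes with the coefficients and
    [e, b] with b. *)
Lemma adb_horner r (T : 'I_r -> A) (e : diffop A) b (Q : {poly mpoly r K}) :
  (forall i, e * mulop (T i) = mulop (T i) * e) ->
  bracket (bracket e b) b = 0 ->
  e * mulop (map_poly (evA T) Q).[b] = mulop (map_poly (evA T) Q).[b] * e
    + mulop (map_poly (evA T) Q)^`().[b] * bracket e b.
Proof.
move=> C E; pose ev : {rmorphism mpoly r K -> A} := mmap (in_alg A) T.
rewrite -[map_poly (evA T) Q]/(map_poly ev Q).
have E2 : bracket e b * mulop b = mulop b * bracket e b.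
  by apply/eqP; rewrite -subr_eq0; apply/eqP.
have E1 : e * mulop b = mulop b * e + bracket e b by rewrite /bracket addrC subrK.
move: (bracket e b) E1 E2 {E} => N E1 E2.
elim/poly_ind: Q => [|Q c IH].
  by rewrite rmorph0 deriv0 horner0 !mulop0 mulr0 !mul0r addr0.
rewrite rmorphD rmorphM /= map_polyX map_polyC /= !derivE !hornerE.
rewrite -/(evA T c) !mulopD !mulopM mulrDr mulrA IH mulrDl -!mulrA E1 E2.
rewrite (evA_mulop c C) !mulrDr !mulrDl !mulrA.
by rewrite -!addrA; congr (_ + _); rewrite addrA addrC; congr (_ + _).
Qed.

Definition alg_basis r (T : 'I_r -> A) := forall b,
  exists Q : {poly mpoly r K}, (map_poly (evA T) Q).[b] = 0 /\
    (map_poly (evA T) Q)^`().[b] != 0.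

Hypothesis domA : forall a b : A, a * b = 0 -> a != 0 -> b = 0.

(** Bracketing with b is nilpotent on e, of finite order. If a double bracket vanishes, Q(b) = 0 and
    [adb_horner] give Q'(b) [e', b] = 0, so the single bracket vanishes too, A being a domain; this
    descends to [e, b] = 0. *)
Lemma alg_basis_comm r (T : 'I_r -> A) (e : diffop A) b : alg_basis T ->
  (forall i, e * mulop (T i) = mulop (T i) * e) -> bracket e b = 0.
Proof.
move=> HT; have [Q [Q0 Q'0]] := HT b.
have step e' : (forall i, e' * mulop (T i) = mulop (T i) * e') ->
    bracket (bracket e' b) b = 0 -> bracket e' b = 0.
  move=> C E; have := adb_horner Q C E; rewrite Q0 mulop0 mulr0 mul0r add0r => E2.
  apply: diffop_ext => x; apply: domA Q'0.
  by have := congr1 (fun d : diffop A => d x) (esym E2).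
have [k ek] := orderP e; move=> C.
have Ck n i : iter n (fun d : diffop A => bracket d b) e * mulop (T i) = mulop (T i) * iter n (fun d : diffop A => bracket d b) e.
  elim: n => //= n IH; rewrite /bracket mulrBl mulrBr -!mulrA [mulop b * mulop _]mulop_comm IH.
  by rewrite !mulrA IH [mulop b * mulop _]mulop_comm.
have Ek : iter k.+1 (fun d : diffop A => bracket d b) e = 0.
  elim: k e ek {C Ck} => [|k IH] e ek; first by rewrite /= /bracket (order0_comm _ ek) subrr.
  by rewrite iterSr; apply: IH; exact: (order_comm b ek).
elim: k Ek {ek} => // k IH Ek; apply: IH; exact: (step _ (Ck k) Ek).
Qed.

Lemma indep_max r0 : ~ (exists T : 'I_r0 -> A, indep T) -> (exists T : 'I_0 -> A, indep T) ->
  exists r (T : 'I_r -> A), indep T /\ forall b, ~ indep (extend T b).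
Proof.
elim: r0 => [//|r IH] H1 H0.
case: (pselect (exists T : 'I_r -> A, indep T)) => [[T iT]|nT]; last exact: IH.
by exists r, T; split=> // b ib; apply: H1; exists (extend T b).
Qed.

Lemma indep0 (T : 'I_0 -> A) : indep T.
Proof.
move=> q; have b0 (b : multinom 0) : b = mnm0 by apply/mnmP => -[].
have -> : q = mpolyC 0 (mcoeff mnm0 q).
  by apply/mpolyP => b; rewrite mcoeffC [b]b0 eqxx mulr1.
rewrite evAC => /eqP; rewrite scaler_eq0 oner_eq0 orbF => /eqP ->.
by rewrite mpolyC0.
Qed.

(** Adding the products T_i a to the test set makes every [e, T_i] vanish on the previous one, hence
    vanish. Then e commutes with all of A, and e(1) = 0 finishes. *)
Lemma alg_basis_test r (T : 'I_r -> A) : alg_basis T ->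
  forall k, exists s : seq A, forall e : diffop A,
  order_le k e -> (forall a, a \in s -> e a = 0) -> e = 0.
Proof.
move=> HT; elim=> [|k [s IH]].
  exists [:: 1] => e e0 H; apply: diffop_ext => x.
  by rewrite -[x]mulr1 e0 H ?inE // mulr0.
exists (1 :: s ++ flatten [seq [seq T i * a | a <- s] | i <- enum 'I_r]) => e ek H.
have C i : e * mulop (T i) = mulop (T i) * e.
  apply/eqP; rewrite -subr_eq0; apply/eqP/IH; first exact: (order_comm _ ek).
  move=> a sa; rewrite diffopEadd diffopEopp !diffopEmul !mulopE.
  rewrite !H ?mulr0 ?subrr // inE mem_cat ?sa ?orbT //.
  apply/orP; right; apply/orP; right; apply/flatten_mapP; exists i; rewrite ?mem_enum //.
  by apply/mapP; exists a.
apply: diffop_ext => x; have := alg_basis_comm x HT C.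
move/(congr1 (fun d : diffop A => d 1)).
rewrite /bracket diffopEadd diffopEopp !diffopEmul !mulopE mulr1.
by rewrite (H 1 (mem_head _ _)) mulr0 subr0.
Qed.

End Algebraic.

(** * Algebraic dependence by counting monomials *)

Section Counting.
Variables (K : fieldType) (n : nat).

Lemma msize_mul_le d e (p q : mpoly n K) :
  (msize p <= d.+1)%N -> (msize q <= e.+1)%N -> (msize (p * q) <= (d + e).+1)%N.
Proof.
have [->|p0] := eqVneq p 0; first by rewrite mul0r msize0.
have [->|q0] := eqVneq q 0; first by rewrite mulr0 msize0.
move=> Hp Hq; rewrite msizeM //.
have : (msize p + msize q <= d.+1 + e.+1)%N by apply: leq_add.
by rewrite addSn addnS; case: (_ + _)%N => [|k] //= ; rewrite ltnS => /leqW.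
Qed.

Lemma msize_exp_le d (p : mpoly n K) k :
  (msize p <= d.+1)%N -> (msize (p ^+ k) <= (k * d).+1)%N.
Proof.
move=> Hp; elim: k => [|k IH]; first by rewrite expr0 msize1.
by rewrite exprS mulSn; apply: msize_mul_le.
Qed.

Lemma msize_prod_le r (a : 'I_r -> mpoly n K) (b : 'I_r -> nat) E N :
  (forall i, (msize (a i) <= E.+1)%N) -> (forall i, (b i <= N)%N) ->
  (msize (\prod_i a i ^+ b i) <= (r * (N * E)).+1)%N.
Proof.
move=> aE bN; rewrite -[X in (X * _)%N]card_ord -sum_nat_const.
apply: (big_ind2 (fun p d => (msize p <= d.+1)%N)) => [|p d q e|i _].
- by rewrite msize1.
- exact: msize_mul_le.
- by apply: leq_trans (msize_exp_le _ (aE i)) _; rewrite ltnS leq_mul2r bN orbT.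
Qed.

Definition mono r N (phi : {ffun 'I_r -> 'I_N}) : multinom r :=
  Multinom [tuple nat_of_ord (phi i) | i < r].

Lemma mono_inj r N : injective (@mono r N).
Proof.
move=> p q E; apply/ffunP => i; apply: val_inj.
by have := congr1 (fun b : multinom r => b i) E; rewrite !mnmE.
Qed.

Lemma ker_row r s (B : 'M[K]_(r, s)) : (s < r)%N ->
  exists v : 'rV_r, v != 0 /\ v *m B = 0.
Proof.
move=> sr; exists (nz_row (kermx B)); split.
  rewrite nz_row_eq0 -mxrank_eq0 mxrank_ker subn_eq0 -ltnNge.
  exact: leq_ltn_trans (rank_leq_col B) sr.
by apply: sub_kermxP; exact: nz_row_sub.
Qed.

(** The N^(n+1) monomials with exponents below N are sent to polynomials in n variables with
    exponents below D. These form a space of dimension D^n < N^(n+1), so a nonzero combination is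
    sent to 0. *)
Lemma alg_dependent (a : 'I_n.+1 -> mpoly n K) :
  exists q : mpoly n.+1 K, q != 0 /\ mmap (@mpolyC n K) a q = 0.
Proof.
pose E := \max_i msize (a i).
(* As D <= N ((n+1) E + 1), this choice gives D^n <= N^n ((n+1) E + 1)^n < N^(n+1). *)
pose N := ((n.+1 * E).+1 ^ n).+1.
pose D := (n.+1 * (N * E)).+1.
pose I : finType := {ffun 'I_n.+1 -> 'I_N}.
pose J : finType := {ffun 'I_n -> 'I_D}.
have cIJ : (#|J| < #|I|)%N.
  rewrite !card_ffun !card_ord expnS.
  apply: (@leq_ltn_trans ((N * (n.+1 * E).+1) ^ n)).
    have DN : (D <= N * (n.+1 * E).+1)%N.
      by rewrite /D mulnS mulnCA -add1n leq_add2r.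
    by elim: {1 3}n => // k IH; rewrite !expnS leq_mul.
  by rewrite expnMn mulnC ltn_pmul2r // expn_gt0.
have aE i : (msize (a i) <= E.+1)%N by apply: leqW; apply: leq_bigmax.
pose pr (phi : I) := \prod_i a i ^+ mono phi i.
pose B := \matrix_(i < #|I|, j < #|J|) mcoeff (mono (enum_val j : J)) (pr (enum_val i)).
have [v [v0 vB]] := ker_row B cIJ.
pose q := \sum_(i < #|I|) v ord0 i *: mpolyX K (mono (enum_val i : I)).
exists q; split.
  apply: contra v0 => /eqP q0; apply/eqP/rowP => i; rewrite mxE.
  have := congr1 (mcoeff (mono (enum_val i : I))) q0.
  rewrite mcoeff0 raddf_sum /= (bigD1 i) //= mcoeffZ mcoeffX eqxx mulr1 big1 ?addr0 // => k ki.
  rewrite mcoeffZ mcoeffX; case: eqP => [/mono_inj/enum_val_inj E1|]; rewrite ?mulr0 //.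
  by rewrite E1 eqxx in ki.
rewrite /q raddf_sum /=; apply/mpolyP => b; rewrite mcoeff0 raddf_sum /=.
under eq_bigr do rewrite mmapZ mmapX mcoeffCM.
case: (boolP [forall k, b k < D]%N) => [/forallP bD|].
  pose phi : J := [ffun k => Ordinal (bD k)].
  have -> : b = mono phi by apply/mnmP => k; rewrite mnmE ffunE.
  have := congr1 (fun w : 'rV_#|J| => w ord0 (enum_rank phi)) vB; rewrite !mxE => E2; rewrite -[RHS]E2.
  by apply: eq_bigr => i _; rewrite !mxE enum_rankK.
rewrite negb_forall => /existsP [k]; rewrite -leqNgt => bk.
rewrite big1 // => i _; rewrite (memN_msupp_eq0 (msize_mdeg_ge _)) ?mulr0 //.
apply: leq_trans (leq_trans bk _).
  by apply: msize_prod_le => // j; rewrite mnmE ltnW.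
by rewrite mdegE (bigD1 k) //= leq_addr.
Qed.

End Counting.

Section FiniteTest.
Variables (K : fieldType) (charK : [pchar K] =i pred0) (A : comAlgType K) (n : nat).
Variables (iota : {lrmorphism A -> mpoly n K}) (iota_inj : injective iota).

(** Inside a polynomial ring in n variables, A is a domain and any n + 1 of its elements are
    dependent. A maximal independent family is an [alg_basis] by [minimal_relation]. *)
Lemma finite_test k : exists s : seq A, forall e : diffop A,
  order_le k e -> (forall a, a \in s -> e a = 0) -> e = 0.
Proof.
have domA (a b : A) : a * b = 0 -> a != 0 -> b = 0.
  move=> /(congr1 iota); rewrite rmorphM rmorph0 => /eqP; rewrite mulf_eq0.
  case/orP => /eqP E; last by move=> _; apply: iota_inj; rewrite E rmorph0.
  suff -> : a = 0 by rewrite eqxx.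
  by apply: iota_inj; rewrite E rmorph0.
have nI : ~ exists T : 'I_n.+1 -> A, indep T.
  case=> T iT; have [q [q0 Eq]] := alg_dependent (iota \o T).
  move/eqP: q0; apply; apply: iT; apply: iota_inj; rewrite rmorph0 -Eq evAE /mmap.
  rewrite raddf_sum; apply: eq_bigr => b _; rewrite /= linearZ /= rmorph_prod mul_mpolyC.
  by congr (_ *: _); apply: eq_bigr => i _; rewrite rmorphXn.
have [|r [T [iT mT]]] := indep_max nI.
  have T0 (i : 'I_0) : A by case: i.
  by exists T0; exact: indep0.
apply: (alg_basis_test domA (T := T)) => b.
by apply: minimal_relation.
Qed.

End FiniteTest.

(** * Comparison of V-filtrations *)

Section Jumps.
Variables (K : fieldType) (A : comAlgType K) (l : nat).
Variable P : lmodType (diffop (polyext A l)).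
Variables (V : rat -> set P) (VP : is_V_filtration V).

Lemma seq_min (s : seq rat) (Q : rat -> Prop) : (exists2 c, c \in s & Q c) ->
  exists2 c, c \in s /\ Q c & forall c', c' \in s -> Q c' -> c <= c'.
Proof.
elim: s => [[c]//|a s IH] [c cs Qc].
case: (pselect (exists2 c, c \in s & Q c)) => [/IH [b [bs Qb] bmin]|nQ].
  case: (pselect (Q a /\ a <= b)) => [[Qa ab]|nQa].
    exists a; first by rewrite mem_head.
    by move=> c'; rewrite inE => /orP[/eqP -> //|c's /bmin -/(_ c's)]; apply: le_trans.
  exists b; first by rewrite inE bs orbT.
  move=> c'; rewrite inE => /orP[/eqP -> Qa|/bmin //].
  by case: (leP b a) => // /ltW ab; exfalso; apply: nQa.
have ca : c = a.
  by move: cs; rewrite inE => /orP[/eqP //|cs]; exfalso; apply: nQ; exists c.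
exists a; first by rewrite mem_head -ca.
move=> c'; rewrite inE => /orP[/eqP -> //|c's Qc']; exfalso.
by apply: nQ; exists c'.
Qed.

(** V is constant from a up to the next jump c, and an element of V^(>c) lies in some V^g with g >
    c. The induction is on the number of entries of s from a on. *)
Lemma jump_ind lo hi (X : set P) : lo <= hi -> V hi `<=` X ->
  (forall a, lo <= a < hi -> V_gt V a `<=` X -> V a `<=` X) -> V lo `<=` X.
Proof.
move=> lohi Xhi step; have [s sP] := Vf_discrete VP lo hi.
suff H k : forall a, lo <= a <= hi -> (size [seq c <- s | (a <= c)%R] < k)%N -> V a `<=` X.
  by apply: (H (size [seq c <- s | (lo <= c)%R]).+1); rewrite ?lexx ?lohi.
elim: k => // k IH a /andP[loa ahi] sk.
case: (pselect (exists2 c, c \in s & a <= c < hi /\ V_jump V c)) => [/seq_min|nj]; last first.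
  rewrite (Vf_constant VP ahi) // => c /andP[ac chi] jc; apply: nj; exists c.
    by apply: sP => //; rewrite (le_trans loa ac) ltW.
  by rewrite ac chi.
move=> [c [cs [/andP[ac chi] jc]] cmin].
have loc := le_trans loa ac.
have -> : V a = V c.
  apply: (Vf_constant VP) => // c' /andP[ac' c'c] jc'.
  have c'hi := lt_trans c'c chi.
  have := cmin c'; rewrite ac' c'hi => /(_ _ (conj isT jc')).
  rewrite leNgt c'c => /(_ (sP _ _ jc')).
  by rewrite (le_trans loa ac') ltW // => /(_ isT).
apply: step; first by rewrite loc.
move=> x [g cg Vg]; case: (leP hi g) => [hg|gh]; first by apply: Xhi; apply: (Vf_decr VP hg).
apply: (IH g) => //; first by rewrite (le_trans loc (ltW cg)) ltW.
rewrite ltnS in sk; apply: leq_trans sk; rewrite !size_filter.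
(* The entry c is counted from a on but not from g on. *)
have : (count (fun c' => (g <= c')%R) s + count (pred1 c) s <= count (fun c' => (a <= c')%R) s)%N.
  rewrite -count_predUI [X in (_ + X)%N](_ : _ = 0%N) ?addn0; last first.
    apply/eqP; rewrite -leqn0 leqNgt -has_count; apply/hasPn => y _ /=.
    by apply/negP => /andP[gy /eqP E]; move: cg; rewrite ltNge -E gy.
  apply: sub_count => y /= /orP[gy|/eqP -> //].
  exact: le_trans (le_trans ac (ltW cg)) gy.
have : (0 < count (pred1 c) s)%N by rewrite -has_count has_pred1.
by move=> c0 H; apply: leq_trans H; rewrite -addn1 leq_add2l.
Qed.

Lemma V_V0 a : is_V0_submodule (V a).
Proof. by case: (Vf_noeth VP a). Qed.
Lemma Vzero a : V a 0. Proof. by case: (V_V0 a). Qed.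
Lemma Vadd a x y : V a x -> V a y -> V a (x + y).
Proof. by case: (V_V0 a) => _ H _; apply: H. Qed.
Lemma Vop a d x : degV 0 d -> V a x -> V a (d *: x).
Proof. by move=> /V_diffopP dV; case: (V_V0 a) => _ _ H; apply: H. Qed.
Lemma Vgt0 a : V_gt V a 0.
Proof. by exists (a + 1); [rewrite ltrDl|apply: Vzero]. Qed.
Lemma Vgt_op a d x : degV 0 d -> V_gt V a x -> V_gt V a (d *: x).
Proof. by move=> dV [g ag Vg]; exists g => //; apply: Vop. Qed.
Lemma Vgt_add a x y : V_gt V a x -> V_gt V a y -> V_gt V a (x + y).
Proof.
move=> [g ag Vg] [g' ag' Vg']; exists (Num.min g g'); first by rewrite lt_min ag.
by apply: Vadd; [apply: (Vf_decr VP _ Vg)|apply: (Vf_decr VP _ Vg')]; rewrite ge_min lexx ?orbT.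
Qed.
Lemma Vsum a (I : Type) (r : seq I) (F : I -> P) :
  (forall i, V a (F i)) -> V a (\sum_(i <- r) F i).
Proof.
by move=> H; apply: big_ind => [||i _]; [exact: Vzero|exact: Vadd|exact: H].
Qed.

Definition euler a : diffop (polyext A l) :=
  \sum_i dT A i * mT A i - mulop ((ratr a : K)%:A).

Lemma degV_scalar (c : K) : degV 0 (mulop (c%:A : polyext A l)).
Proof. rewrite scalarE -liftop_mulop; exact: degV_lift. Qed.

Lemma degV_euler a : degV 0 (euler a).
Proof.
apply: degV_add; last by apply: degV_opp; apply: degV_scalar.
apply: big_ind => [||i _]; [|exact: degV_add|].
  by move=> j p _; rewrite diffopE0; apply: tadic0.
exact: (degV_mul (degV_dT i) (degV_mT i)).
Qed.


Lemma euler_comm a b : GRing.comm (euler a) (euler b).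
Proof.
have C (c : K) (x : diffop (polyext A l)) : GRing.comm x (mulop (c%:A)).
  by rewrite /GRing.comm mulop_scalar_comm.
by apply: commrB => //; apply/commr_sym/commrB => //; apply: commr_refl.
Qed.

End Jumps.

Lemma ratr_neq (K : fieldType) (charK : [pchar K] =i pred0) (a b : rat) :
  a != b -> ratr a != ratr b :> K.
Proof.
have intr0 (z : int) : (z%:~R == 0 :> K) = (z == 0).
  case: z => [[|k]|k] //=; first by rewrite eqxx.
    exact: negbTE (nat_neq0 charK k).
  by rewrite NegzE mulrNz oppr_eq0; exact: negbTE (nat_neq0 charK k).
apply: contra; rewrite /ratr eqr_div ?intr0 ?denq_neq0 // -subr_eq0 -!rmorphM -rmorphB intr0.
rewrite subr_eq0 -[X in _ -> X == _]divq_num_den -[X in _ -> _ == X]divq_num_den.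
by rewrite eqr_div ?intr_eq0 ?denq_neq0 // -!rmorphM /= eqr_int.
Qed.

(** * Compatibility of Psi with the V-filtrations *)

Section Comparison.
Variables (K : fieldType) (charK : [pchar K] =i pred0) (A : comAlgType K).
Hypothesis finite_test : forall k, exists s : seq A, forall e : diffop A,
  order_le k e -> (forall a, a \in s -> e a = 0) -> e = 0.
Variables (l m : nat) (f : 'I_l -> A) (g : 'I_m -> A) (M : lmodType (diffop A)).
Variables (G : graph_module f M) (H : graph_module g M).
Variables (c : 'I_m -> 'I_l -> A) (cE : forall j, g j = \sum_i c j i * f i).
Variables (d : 'I_l -> 'I_m -> A) (dE : forall i, f i = \sum_j d i j * g j).
Variables (V : rat -> set G) (VP : is_V_filtration V).
Variables (W : rat -> set H) (WP : is_V_filtration W).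
Local Notation Psi := (@Psi K charK A l m f g M G H c cE).

(* The restriction to M' of the V-filtration along (t, u) of the graph module
   of (f, g), in which M' embeds and which projects onto M'' *)
Definition Vgraph (b : rat) : set G :=
  [set x | forall w, W (b + (size w)%:R) (Psi (mTw A w *: x))].

Lemma Vgraph_W b x : Vgraph b x -> W b (Psi x).
Proof. by move/(_ [::]); rewrite mTw_nil scale1r addr0. Qed.

Lemma Vgraph_le b b' : b' <= b -> Vgraph b `<=` Vgraph b'.
Proof. by move=> bb x Sx w; apply: (Vf_decr WP _ (Sx w)); rewrite lerD2r. Qed.

Lemma Vgraph0 b : Vgraph b 0.
Proof. by move=> w; rewrite scaler0 Psi0; apply: Vzero. Qed.

Lemma VgraphD b x y : Vgraph b x -> Vgraph b y -> Vgraph b (x + y).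
Proof. by move=> Sx Sy w; rewrite scalerDr PsiD; apply: Vadd. Qed.

Lemma size_cons b (i : 'I_l) w : b + (size (i :: w))%:R = b + 1 + (size w)%:R :> rat.
Proof. by rewrite /= -addrA -[(size w).+1]add1n natrD. Qed.

Lemma Vgraph_mT b i x : Vgraph b x -> Vgraph (b + 1) (mT A i *: x).
Proof.
by move=> Sx w; rewrite -(size_cons b i) scalerA -mTw_consr; apply: Sx.
Qed.

Lemma Vgraph_dT b i x : Vgraph b x -> Vgraph (b - 1) (dT A i *: x).
Proof.
move=> Sx w; elim: w b x Sx => [|j w IH] b x Sx.
  rewrite mTw_nil scale1r addr0 Psi_dT; apply: (Vsum WP) => j.
  apply: (Vop WP); first exact: degV_lift.
  by apply: (Vf_derT WP); apply: Vgraph_W.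
rewrite mTw_consr -scalerA.
have -> : mT A j *: (dT A i *: x) = dT A i *: (mT A j *: x) - (i == j)%:R *: x.
  by rewrite !scalerA dT_mT scalerDl addrK.
rewrite size_cons subrK scalerBr PsiD PsiN; apply: Vadd => //.
  by rewrite -[b](addrK 1); apply: IH; apply: Vgraph_mT.
case: eqP => _; last by rewrite scale0r scaler0 Psi0 oppr0; apply: Vzero.
rewrite scale1r -scaleN1r; apply: Vop => //.
rewrite -mulop1 -mulopN -(@tconst1 K A m) -tconstN -liftop_mulop; exact: degV_lift.
Qed.

(** Each layer of [exp_ad] multiplies the argument by some t_i and differentiates once outside, so
    the shifts +1 and -1 cancel. *)
Lemma Vgraph_exp_ad k e b y : Vgraph b y -> W b (@exp_ad K charK A l m f g M G H c cE k e y).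
Proof.
elim: k e b y => [|k IH] e b y Sy /=.
  by apply: Vop => //; [exact: degV_lift|exact: Vgraph_W].
apply: Vsum => // p; rewrite -[b](addrK 1); apply: (Vf_derT WP).
by apply: IH; apply: Vgraph_mT.
Qed.

Lemma Vgraph_lift e b x : Vgraph b x -> Vgraph b (liftop l e *: x).
Proof.
move=> Sx w; rewrite scalerA -mTw_lift -scalerA.
have [k ek] := orderP e; rewrite (Psi_lift _ _ _ _ ek).
apply: Vsum => // i; apply: Vop => //; first exact: degV_scalar.
apply: Vgraph_exp_ad => w'; rewrite scalerA /mTw -big_cat -addrA -natrD.
by rewrite addnC -size_cat; exact: Sx.
Qed.

Lemma Vgraph_deg r D b x : degV r D -> Vgraph b x -> Vgraph (b + r%:~R) (D *: x).
Proof.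
pose L r (D : diffop (polyext A l)) := forall b x, Vgraph b x -> Vgraph (b + r%:~R) (D *: x).
move=> HD; have : L r D.
  apply: (degV_generated charK finite_test (L := L)) => //.
  - by move=> r' b' y _; rewrite scale0r; apply: Vgraph0.
  - by move=> r' D1 D2 H1 H2 b' y Sy; rewrite scalerDl; apply: VgraphD; [apply: H1|apply: H2].
  - move=> r1 r2 D1 D2 H1 H2 b' y Sy; rewrite -scalerA intrD addrA addrAC.
    by apply: (H1); apply: H2.
  - move=> r1 r2 D1 r12 H1 b' y /H1; apply: Vgraph_le.
    by rewrite lerD2l ler_int.
  - by move=> i b' y; apply: Vgraph_mT.
  - by move=> i b' y; rewrite mulrN1z; apply: Vgraph_dT.
  - by move=> e b' y; rewrite addr0; apply: Vgraph_lift.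
exact.
Qed.

(** By f = d g, the product t_i delta(v) = delta(f_i v) has image sum_j d_ij u_j delta(v) in M'', so
    each t_i gains one step of W. *)
Lemma Vgraph_delta b v : W b (delta H v) -> Vgraph b (delta G v).
Proof.
move=> Wv w; elim: w b v Wv => [|i w IH] b v Wv.
  by rewrite mTw_nil scale1r addr0 Psi_delta.
rewrite mTw_consr -scalerA delta_mT size_cons; apply: IH.
rewrite dE mulop_sum scaler_suml.
rewrite (big_morph (delta H) (@deltaD _ _ _ _ _ H) (delta_0 H)).
apply: Vsum => // j; rewrite mulopM -scalerA -delta_tconst -liftop_mulop.
apply: Vop => //; first exact: degV_lift.
by rewrite -delta_mT; apply: (Vf_mulT WP).
Qed.

Lemma Vgraph_exhaust x : exists b, Vgraph b x.
Proof.
move: x; apply: (gm_ind charK) => [x y [b Sx] [b' Sy]|v|i x [b Sx]].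
- exists (Num.min b b'); apply: VgraphD; [apply: Vgraph_le Sx|apply: Vgraph_le Sy];
    by rewrite ge_min lexx ?orbT.
- by have [b Wv] := Vf_exhaust WP (delta H v); exists b; apply: Vgraph_delta.
- by exists (b - 1); apply: Vgraph_dT.
Qed.

Lemma V_sub_Vgraph : exists a b, forall k : nat, V (a + k%:R) `<=` Vgraph (b + k%:R).
Proof.
(* Starting at this threshold makes V^(a+k+1) = sum_i t_i V^(a+k) available for every k. *)
have [a aP] := Vf_large VP; exists a.
(* This chain stabilizes at some k0, and since [Vgraph] is exhaustive, V^a lies in Vgraph(-k0). *)
have [_ /(_ (fun k => V a `&` Vgraph (- k%:R)))] := Vf_noeth VP a.
case=> [k|k0 k0P].
  split; last first.
  - by move=> x [Vx Sx]; split=> //; apply: Vgraph_le Sx; rewrite lerN2 ler_nat.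
  - by move=> x [].
  split.
  - by split; [apply: Vzero|apply: Vgraph0].
  - by move=> x y [Vx Sx] [Vy Sy]; split; [apply: Vadd|apply: VgraphD].
  - move=> D x /V_diffopP DV [Vx Sx]; split; first exact: (Vop VP).
    by rewrite -[- _]addr0; exact: (Vgraph_deg (r := 0)).
exists (- k0%:R); elim=> [|k IH] x.
  rewrite !addr0 => Vx; have [b Sx] := Vgraph_exhaust x.
  have [k kb] : exists k, (k0 <= k)%N /\ - k%:R <= b.
    exists (maxn k0 (Num.bound `|b|)); split; first exact: leq_maxl.
    rewrite lerNl; apply: (@le_trans _ _ `|b|); first by rewrite -normrN ler_norm.
    apply: le_trans (ltW (archi_boundP (normr_ge0 b))) _.
    by rewrite ler_nat leq_maxr.
  have [k0k kb'] := kb.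
  have : (V a `&` Vgraph (- k%:R)) x by split=> //; apply: Vgraph_le Sx.
  by rewrite k0P // => -[].
rewrite -[k.+1]addn1 natrD !addrA aP ?lerDl ?ler0n // => -[z [Vz ->]].
apply: (big_ind (Vgraph _)) => [||i _]; [exact: Vgraph0|exact: VgraphD|].
by apply: Vgraph_mT; apply: IH.
Qed.

Lemma Psi_eulerE a x : Psi (euler A l a *: x) = euler A m a *: Psi x.
Proof.
rewrite /euler scalerBl [RHS]scalerBl PsiD PsiN Psi_euler; congr (_ - _).
by rewrite !scalarE -!liftop_mulop Psi_const.
Qed.

(* [euler a - euler b] is a nonzero scalar when [a != b], so that the
   generalized eigenspaces for [a] and [b] separate *)
Lemma split_eigen a b n : a != b -> forall k k' x, (k + k' <= n)%N ->
  V a x -> W b (Psi x) -> V_gt V a (euler A l a ^+ k *: x) ->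
  V_gt W b (euler A m b ^+ k' *: Psi x) ->
  exists y z, [/\ x = y + z, V_gt V a y /\ W b (Psi y) & V a z /\ V_gt W b (Psi z)].
Proof.
(* If k = 0 then x itself is in V^(>a), and z = 0; if k' = 0 then Psi x is in W^(>b), and y = 0. *)
move=> ab; elim: n => [|n IH] [|k] [|k'] x // kn Vx Wx Vk Wk.
- exists x, 0; rewrite addr0; move: Vk; rewrite scale1r => Vk; split=> //.
  by rewrite Psi0; split; [apply: Vzero|apply: Vgt0].
- exists x, 0; rewrite addr0; move: Vk; rewrite scale1r => Vk; split=> //.
  by rewrite Psi0; split; [apply: Vzero|apply: Vgt0].
- exists x, 0; rewrite addr0; move: Vk; rewrite scale1r => Vk; split=> //.
  by rewrite Psi0; split; [apply: Vzero|apply: Vgt0].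
- exists 0, x; rewrite add0r; move: Wk; rewrite scale1r => Wk; split=> //.
  by rewrite Psi0; split; [apply: Vgt0|apply: Vzero].
rewrite addSn ltnS in kn.
pose r : K := (ratr b - ratr a)^-1.
have r0 : (ratr b - ratr a : K) != 0 by rewrite subr_eq0 eq_sym; apply: ratr_neq.
pose rl : diffop (polyext A l) := mulop (r%:A); pose rm : diffop (polyext A m) := mulop (r%:A).
have Psi_r y : Psi (rl *: y) = rm *: Psi y.
  by rewrite /rl /rm !scalarE -!liftop_mulop Psi_const.
have dr : degV 0 rl by exact: degV_scalar.
have drm : degV 0 rm by exact: degV_scalar.
(* As euler a - euler b is the scalar ratr b - ratr a, inverse to r, x splits into two parts. On the
   first, the exponent for a drops by one; on the second, the exponent for b does. *)
have E : x = euler A l a *: (rl *: x) + euler A l b *: (- (rl *: x)).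
  rewrite scalerN -scalerBl.
  have -> : euler A l a - euler A l b = mulop ((ratr b - ratr a : K)%:A).
    by rewrite /euler opprB [LHS]addrC addrA subrK scalerBl mulopB.
  rewrite scalerA -mulopM mulr_algl scalerA mulfV // scale1r mulop1 scale1r //.
have [|||||y1 [z1 [E1 [Vy1 Wy1] [Vz1 Wz1]]]] := IH k k'.+1 (euler A l a *: (rl *: x)) => //.
- by apply: Vop => //; [exact: degV_euler|exact: Vop].
- rewrite Psi_eulerE Psi_r; apply: Vop => //; [exact: degV_euler|exact: Vop].
- rewrite scalerA -exprSr scalerA -mulop_scalar_comm -scalerA; exact: Vgt_op.
- rewrite Psi_eulerE Psi_r scalerA.
  have -> : euler A m b ^+ k'.+1 * euler A m a = euler A m a * euler A m b ^+ k'.+1.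
    by apply/commr_sym/commrX/euler_comm.
  rewrite -scalerA [_ *: (rm *: _)]scalerA -[_ * rm]mulop_scalar_comm -[(rm * _) *: _]scalerA.
  by apply: Vgt_op => //; [exact: degV_euler|exact: Vgt_op].
have NE (u : H) : - u = mulop ((- 1 : K)%:A) *: u.
  by rewrite scaleN1r mulopN mulop1 scaleN1r.
have NE' (u : G) : - u = mulop ((- 1 : K)%:A) *: u.
  by rewrite scaleN1r mulopN mulop1 scaleN1r.
have [|||||y2 [z2 [E2 [Vy2 Wy2] [Vz2 Wz2]]]] := IH k.+1 k' (euler A l b *: (- (rl *: x))) => //.
- by rewrite addSn -addnS.
- by apply: Vop => //; [exact: degV_euler|rewrite NE'; apply: Vop => //; [exact: degV_scalar|exact: Vop]].
- rewrite Psi_eulerE PsiN Psi_r; apply: Vop => //; first exact: degV_euler.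
  by rewrite NE; apply: Vop => //; [exact: degV_scalar|exact: Vop].
- rewrite scalerA.
  have -> : euler A l a ^+ k.+1 * euler A l b = euler A l b * euler A l a ^+ k.+1.
    by apply/commr_sym/commrX/euler_comm.
  rewrite NE' !scalerA -!mulrA; set s := euler A l a ^+ k.+1 * _.
  have -> : s = mulop ((-1 : K)%:A) * rl * euler A l a ^+ k.+1.
    by rewrite /s mulrA -[_ ^+ _ * mulop _]mulop_scalar_comm -!mulrA -[_ ^+ _ * rl]mulop_scalar_comm.
  rewrite -!scalerA.  apply: (Vgt_op VP (@degV_euler K A l b)).
  by apply: (Vgt_op VP (@degV_scalar K A l _)); exact: (Vgt_op VP dr Vk).
- rewrite Psi_eulerE PsiN Psi_r scalerA -exprSr NE.
  rewrite !scalerA; set s := euler A m b ^+ k'.+1 * _.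
  have -> : s = mulop ((-1 : K)%:A) * rm * euler A m b ^+ k'.+1.
    by rewrite /s mulrA -[_ ^+ _ * mulop _]mulop_scalar_comm -!mulrA -[_ ^+ _ * rm]mulop_scalar_comm.
  rewrite -!scalerA.
  by apply: (Vgt_op WP (@degV_scalar K A m _)); exact: (Vgt_op WP drm Wk).
exists (y1 + y2), (z1 + z2); split.
- by rewrite E E1 E2 addrACA.
- by rewrite PsiD; split; [apply: Vgt_add|apply: Vadd].
- by rewrite PsiD; split; [apply: Vadd|apply: Vgt_add].
Qed.

(** Two nested inductions on jumps. The outer one raises the level b' < a at which Psi x is known to
    lie in W; the inner one raises the level a1 >= a of x in V, up to one where [V_sub_Vgraph]
    concludes. As a1 differs from b', [split_eigen] cuts the element into a part for each
    induction. *)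
Lemma Psi_V a x : V a x -> W a (Psi x).
Proof.
have [a0 [b0 VS]] := V_sub_Vgraph.
(* Large enough for V^(a0+k) to be mapped into W^(b0+k), hence into W^a, and for a0 + k to lie above
   a. *)
pose k := maxn (Num.bound `|a - b0|) (Num.bound `|a - a0|).
have [kb ka] : a <= b0 + k%:R /\ a <= a0 + k%:R.
  split; rewrite -lerBlDl; apply: (le_trans (ler_norm _));
    apply: (le_trans (ltW (archi_boundP (normr_ge0 _))));
    by rewrite ler_nat /k ?leq_maxl ?leq_maxr.
have Vhi : V (a0 + k%:R) `<=` [set x | W a (Psi x)].
  by move=> y /VS /Vgraph_W; apply: (Vf_decr WP).
move=> Vx; have [b Wb] := Vf_exhaust WP (Psi x).
pose Y : set H := [set z | forall y, V a y -> Psi y = z -> W a z].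
suff WY : W (Num.min a b) `<=` Y.
  by apply: (WY _ _ x) => //; apply: (Vf_decr WP _ Wb); rewrite ge_min lexx orbT.
apply: (jump_ind WP (hi := a)) => [||b' /andP[_ ba] Ygt]; first by rewrite ge_min lexx.
  by move=> z Wz.
move=> _ /[swap] y /[swap] Vy /[swap] <- Wy.
suff : V a `<=` [set y | W b' (Psi y) -> W a (Psi y)] by move/(_ _ Vy Wy).
apply: (jump_ind VP ka); first by move=> z Vz _; exact: Vhi.
move=> a1 /andP[aa1 _] Xgt z Vz Wz.
have [n1 H1] := Vf_nilp VP a1; have [n2 H2] := Vf_nilp WP b'.
have ab : a1 != b' by rewrite gt_eqF // (lt_le_trans ba).
have [z1 [z2 [-> [Vz1 Wz1] [Vz2 Wz2]]]] :=
  split_eigen ab (leqnn (n1 + n2)) Vz Wz (H1 _ Vz) (H2 _ Wz).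
rewrite PsiD; apply: Vadd => //; first exact: Xgt.
by apply: (Ygt _ Wz2 z2) => //; apply: (Vf_decr VP aa1).
Qed.

(** The product of the graph equations acts bijectively on the localization, so the fraction
    representing v is unique. *)
Lemma meet_baseE (n : nat) (h : 'I_n -> A) (P : graph_module h M) (S : set P) :
  meet_base S = [set v | S (delta P v)].
Proof.
apply/seteqP; split=> v /=.
  move=> [y [Ey Sy]]; suff -> : delta P v = gm_pi P y by [].
  congr (gm_pi P _); apply: (@h_inj _ _ _ _ _ P).
  by rewrite /delta0 hinvK -Ey.
by move=> Sv; exists (delta0 P v); split=> //; rewrite /delta0 hinvK.
Qed.

Lemma meet_base_sub a : meet_base (V a) `<=` meet_base (W a).
Proof.
by rewrite !meet_baseE => v /= /Psi_V; rewrite Psi_delta.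
Qed.

End Comparison.

Lemma ideal_gen_sub (B : comNzRingType) (l m : nat) (f : 'I_l -> B) (g : 'I_m -> B) :
  ideal_gen g `<=` ideal_gen f ->
  exists c : 'I_m -> 'I_l -> B, forall j, g j = \sum_i c j i * f i.
Proof.
move=> gf.
suff /choice [c cE] : forall j, exists cj : 'I_l -> B, g j = \sum_i cj i * f i by exists c.
move=> j; apply: gf; exists (fun j' => (j' == j)%:R).
rewrite (bigD1 j) //= eqxx mul1r big1 ?addr0 // => j' /negbTE ->.
by rewrite mul0r.
Qed.

Theorem corollary4p12 (RR : realType) (K : fieldType)
    (charK : [pchar K] =i pred0) (n : nat)
    (A : comAlgType K) (iota : {lrmorphism A -> mpoly n K})
    (iota_inj : injective iota)
    (beta : mpoly n K -> A) (betaP : is_splitting iota beta)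
    (extA : diff_extensible iota)
    (N : lmodType (diffop (mpoly n K))) (regN : qu_regular_holonomic RR N)
    (M : lmodType (diffop A)) (j : M -> N) (sumM : diff_ext_summand betaP j)
    (l m : nat) (f : 'I_l -> A) (g : 'I_m -> A) (I : set A)
    (If : ideal_gen f = I) (Ig : ideal_gen g = I)
    (M' : graph_module f M) (M'' : graph_module g M)
    (V : rat -> set M') (VP : is_V_filtration V)
    (W : rat -> set M'') (WP : is_V_filtration W) :
  forall alpha : rat, meet_base (V alpha) = meet_base (W alpha).
Proof.
move=> alpha.
have [c cE] : exists c : 'I_m -> 'I_l -> A, forall j, g j = \sum_i c j i * f i.
  by apply: ideal_gen_sub; rewrite If Ig.
have [d dE] : exists d : 'I_l -> 'I_m -> A, forall i, f i = \sum_j d i j * g j.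
  by apply: ideal_gen_sub; rewrite If Ig.
have test := finite_test charK iota_inj.
by apply/seteqP; split; [apply: (meet_base_sub charK test cE dE)|
  apply: (meet_base_sub charK test dE cE)].
Qed.
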